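(* Let $G$ be an infinite, connected, bipartite graph with vertex classes coloured black and white, such that the coloured graph is quasi-transitive and every black vertex has degree $3$. Let $\phi$ be a local transformation and let $\widetilde G$ be obtained from $G$ by applying $\phi$ at each black vertex (and leaving white vertices unchanged), assumed connected. Then the connective constants $\mu=\mu(G)$ and $\widetilde\mu=\mu(\widetilde G)$ satisfy \[ \mu^{-2}=h(\widetilde\mu^{-1}),\qquad h(x)=x\,g_\phi(x). \]
   Context: All graphs are simple. For a bipartite graph with a colouring $\chi$ of its two classes, the coloured-automorphism group consists of graph automorphisms preserving colours; the coloured graph is quasi-transitive if there is a finite $W\subseteq V$ such that for every vertex $v$ some coloured automorphism $\alpha$ has $\alpha v\in W$. The connective constant of a quasi-transitive graph is $\mu=\lim_n\sigma_n(v)^{1/n}$, $\sigma_n(v)$ the number of $n$-step self-avoiding walks from $v$. Local transformation: a local transformation $\phi$ acts at a degree-$3$ vertex $v$ of a simple graph by replacing $v$ with a finite connected graph (the gadget) $\phi(v)$ having three distinct distinguished outer vertices (ports) $w_1,w_2,w_3$, each port being attached to exactly one of the three edges formerly incident to $v$ (one port per edge). It is required that (i) all gadgets $\phi(v)$ are isomorphic via isomorphisms sending ports to ports, and (ii) some subgroup of the automorphism group of $\phi(v)$ preserves the set $\{w_1,w_2,w_3\}$ and acts transitively on it. Mid-edge convention: each edge $e$ is identified with a point at its middle. Walks may start and end at mid-edges; such a walk is self-avoiding (a SAW) if it visits no vertex and no mid-edge more than once, and its length $|\pi|$ is the number of vertices it visits. Gadget series: for a degree-$3$ vertex $v$ with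 incident edges $e_1,e_2,e_3$, $g(x)=g_\phi(x)=\sum_{\pi}x^{|\pi|}$, where the sum is over all SAWs $\pi$ that start at the mid-edge of $e_1$, end at the mid-edge of $e_2$, and otherwise visit only vertices of the gadget $\phi(v)$. This polynomial does not depend on $v$ nor on the chosen pair of incident edges. *)

(* Defs.v *)
From HB Require Import structures.
From mathcomp Require Import all_boot all_order all_algebra.
From mathcomp Require Import fingroup perm action.
From mathcomp Require Import all_classical all_reals all_analysis.
Set Implicit Arguments. Unset Strict Implicit. Unset Printing Implicit Defensive.
Import Order.TTheory GRing.Theory Num.Theory.
Local Open Scope ring_scope.
Local Open Scope classical_set_scope.
Import numFieldNormedType.Exports.

Section Graphs.
Variable V : eqType.
Variable adj : rel V.

Definition simple_graph : Prop :=
  (forall x y, adj x y = adj y x) /\ (forall x, ~~ adj x x).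

Definition graph_connected : Prop :=
  forall u v, exists p : seq V, path adj u p /\ last u p = v.

Definition locally_finite : Prop :=
  forall v, finite_set [set w | adj v w].

Definition infinite_graph : Prop := ~ finite_set [set: V].

Definition is_saw (v : V) (n : nat) (p : seq V) : Prop :=
  size p = n /\ path adj v p /\ uniq (v :: p).

Definition saw_count (v : V) (n k : nat) : Prop :=
  exists s : seq (seq V), uniq s /\ size s = k /\
    (forall p, p \in s <-> is_saw v n p).

Definition connective_constant {R : realType} (mu : R) : Prop :=
  forall v, exists sigma : nat -> nat,
    (forall n, saw_count v n (sigma n)) /\
    (fun n : nat => (sigma n)%:R `^ (n%:R)^-1) @ \oo --> mu.

Definition coloured_automorphism (chi : V -> bool) (f : V -> V) : Prop :=
  bijective f /\ (forall x y, adj (f x) (f y) = adj x y) /\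
  (forall x, chi (f x) = chi x).

Definition coloured_quasi_transitive (chi : V -> bool) : Prop :=
  exists W : set V, finite_set W /\
    forall v, exists f, coloured_automorphism chi f /\ W (f v).

Definition bipartite_colouring (chi : V -> bool) : Prop :=
  forall x y, adj x y -> chi x != chi y.
End Graphs.

Section Gadget.
Variable K : finType.
Variable gadj : rel K.
Variable w : 'I_3 -> K.

Definition gadget_aut : {set {perm K}} :=
  [set f : {perm K} | [forall a, forall b, gadj (f a) (f b) == gadj a b]].

Definition ports : {set K} := [set w i | i : 'I_3].

Definition valid_gadget : Prop :=
  [/\ (forall a b, gadj a b = gadj b a) /\ (forall a, ~~ gadj a a),
      (forall a b, connect gadj a b),
      injective w &
      exists H : {group {perm K}},
        [/\ H \subset gadget_aut, [acts H, on ports | 'P]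
          & [transitive H, on ports | 'P]]].

Definition port1 : 'I_3 := @Ordinal 3 1 isT.

(* SAWs inside the gadget from the mid-edge of e_1 to the mid-edge of e_2:
   the vertex sequence starts at port w 0, ends at port w 1, is a
   self-avoiding gadget path; its length is its number of vertices *)
Definition gadget_saw (p : seq K) : bool :=
  if p is x :: q then
    [&& x == w ord0, path gadj x q, uniq p & last x q == w port1]
  else false.

Definition gadget_series {R : pzRingType} (x : R) : R :=
  \sum_(n < #|K|.+1) \sum_(t : n.-tuple K | gadget_saw t) x ^+ n.
End Gadget.

(* The transformed graph: white vertices of G, plus a copy of the gadget
   for each black vertex v; port w i of the copy at v is joined to the
   neighbour nb v i of v (the edge {v, nb v i} is attached to port w i). *)
Section Transform.
Variable V : eqType.
Variable adj : rel V.
Variable chi : V -> bool. (* true = black *)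
Variable K : finType.
Variable gadj : rel K.
Variable w : 'I_3 -> K.
Variable nb : V -> 'I_3 -> V.

Definition tvert : eqType :=
  ({u : V | ~~ chi u} + ({v : V | chi v} * K))%type.

Definition tadj (x y : tvert) : bool :=
  match x, y with
  | inl u, inl u' => false
  | inl u, inr (v, a) =>
      adj (val u) (val v) && [exists i, (nb (val v) i == val u) && (a == w i)]
  | inr (v, a), inl u =>
      adj (val u) (val v) && [exists i, (nb (val v) i == val u) && (a == w i)]
  | inr (v, a), inr (v', b) => (v == v') && gadj a b
  end.

Definition attachment : Prop :=
  forall v, chi v -> injective (nb v) /\
    (forall u, adj v u <-> exists i, nb v i = u).

End Transform.
Arguments tadj [V] adj chi [K] gadj w nb x y.

(* Main.v *)
Require Import Defs.
From HB Require Import structures.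
From mathcomp Require Import all_boot all_order all_algebra.
From mathcomp Require Import fingroup perm action.
From mathcomp Require Import all_classical all_reals all_analysis.
From mathcomp Require Import zify ring lra.
Import Order.TTheory GRing.Theory Num.Theory.
Import numFieldNormedType.Exports.
Local Open Scope ring_scope.
Local Open Scope classical_set_scope.
Local Open Scope card_scope.
Set Implicit Arguments. Unset Strict Implicit.

(** A self-avoiding walk of the transformed graph joining two white vertices
    meets no gadget twice, since a gadget has only three ports. It is therefore
    a self-avoiding walk of [G] of even length in which each black vertex is
    replaced by a traversal of its gadget, and the walks that arise from one
    walk with [2k] steps have generating function [h(x)^k]. Let [x] solve
    [h(x) = mu^-2]. Every white-to-white walk is a lift and [h] is increasing,
    so the walk counts of the transformed graph are [O(y^n)] for each
    [y > 1/x]. Conversely, the lifts of all walks with [2n] steps have total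
    weight [sigma_2n h(x)^n], which is not exponentially small; each of them
    has between [n] and [O(n)] steps, and cutting it after [n] steps while
    bounding the rest by the upper estimate gives the matching lower bound.

    The symmetry of the gadget permutes the ports transitively but need not
    realise all their permutations, so the transformed graph need not be
    quasi-transitive, and Hammersley's theorem does not apply to it: the
    existence of its connective constant comes from these estimates. What does
    hold in any connected graph is that, given a uniform upper exponential
    rate, the lower rate at one vertex propagates to its neighbours. *)

(** * Counting self-avoiding walks *)

Section SawCounting.
Local Open Scope nat_scope.
Variables (T : eqType) (e : rel T) (N : T -> seq T).
Hypothesis N_uniq : forall x, uniq (N x).
Hypothesis mem_N : forall x y, (y \in N x) = e x y.

Fixpoint walks (x : T) (n : nat) : seq (seq T) :=
  if n is n'.+1 then flatten [seq [seq y :: p | p <- walks y n'] | y <- N x]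
  else [:: [::]].

Definition saws (x : T) (n : nat) := [seq p <- walks x n | uniq (x :: p)].

Definition sigma (x : T) (n : nat) := size (saws x n).

Lemma mem_walks x n p : (p \in walks x n) = (size p == n) && path e x p.
Proof.
elim: n x p => [|n IH] x p /=.
  by rewrite inE; case: p.
apply/flatten_mapP/idP => [[y yN /mapP[q]]|].
  by rewrite IH => /andP[/eqP <- pq] ->; rewrite /= eqxx -mem_N yN.
case: p => [//|y q] /= /andP[/eqP[sq] /andP[exy pq]].
exists y; rewrite ?mem_N//; apply/map_f.
by rewrite IH sq eqxx.
Qed.

Lemma walks_uniq x n : uniq (walks x n).
Proof.
elim: n x => [//|n IH] x /=.
apply: (@allpairs_uniq_dep _ _ _ (fun y p => y :: p) (N x) (fun y => walks y n)).
- exact: N_uniq.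
- by move=> y _; exact: IH.
- by move=> [y p] [y' p'] _ _ /= [-> ->].
Qed.

Lemma saws_uniq x n : uniq (saws x n).
Proof. exact/filter_uniq/walks_uniq. Qed.

Lemma mem_saws x n p :
  (p \in saws x n) = [&& size p == n, path e x p & uniq (x :: p)].
Proof. by rewrite mem_filter mem_walks andbC andbA. Qed.

Lemma saw_count_sigma x n : saw_count e x n (sigma x n).
Proof.
exists (saws x n); split; [exact: saws_uniq|split=> //] => p.
rewrite mem_saws /is_saw; split=> [/and3P[/eqP ? ? ?]|[/eqP -> [-> ->]]] //.
Qed.

(** Cutting after [j] steps is injective, and the remaining [n] steps form a self-avoiding walk from
    the cut vertex. The predicate [A] later restricts to walks that are at a white vertex when
    cut. *)
Lemma count_saws_cut (A : pred (seq T)) x j n t :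
  (forall q, q \in saws x j -> A q -> sigma (last x q) n <= t) ->
  count (fun p => A (take j p)) (saws x (j + n)) <= count A (saws x j) * t.
Proof.
move=> At.
pose L := flatten [seq [seq q ++ r | r <- saws (last x q) n]
                      | q <- [seq q <- saws x j | A q]].
apply: (@leq_trans (size L)).
  rewrite -size_filter; apply: uniq_leq_size; first exact/filter_uniq/saws_uniq.
  move=> p; rewrite mem_filter mem_saws => /and4P[Ap /eqP sp pp up].
  have sq : size (take j p) = j by rewrite size_takel// sp leq_addr.
  move: pp up; rewrite -{1 2}(cat_take_drop j p) cat_path -cat_cons cat_uniq.
  move=> /andP[p1 p2] /and3P[u1 u12 u2].
  apply/flatten_mapP; exists (take j p).
    by rewrite mem_filter Ap mem_saws sq eqxx p1.
  apply/mapP; exists (drop j p); last by rewrite cat_take_drop.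
  rewrite mem_saws size_drop sp p2 /= u2 andbT; apply/andP; split.
    by apply/eqP; lia.
  apply: contra u12 => ld; apply/hasP; exists (last x (take j p)) => //.
  exact: mem_last.
rewrite size_flatten /shape -map_comp -size_filter sumnE big_map.
have : {in [seq q <- saws x j | A q], forall q, sigma (last x q) n <= t}.
  by move=> q; rewrite mem_filter => /andP[Aq qs]; exact: At.
elim: [seq q <- saws x j | A q] => [|q s IH] H; first by rewrite big_nil.
rewrite big_cons /= mulSn size_map leq_add//; first by apply: H; rewrite inE eqxx.
by apply: IH => r rs; apply: H; rewrite inE rs orbT.
Qed.

Lemma sigma_add x j n t :
  (forall y, sigma y n <= t) -> sigma x (j + n) <= sigma x j * t.
Proof.
move=> H; have := @count_saws_cut predT x j n t (fun q _ _ => H _).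
by rewrite !count_predT.
Qed.

Lemma sigma0 x : sigma x 0 = 1.
Proof. by []. Qed.

Lemma sigma1 x : irreflexive e -> sigma x 1 = size (N x).
Proof.
move=> ei; rewrite /sigma size_filter /= -[RHS](size_map (fun y => [:: y])).
rewrite -[flatten _]/(flatten [seq [:: [:: y]] | y <- N x]).
have -> : flatten [seq [:: [:: y]] | y <- N x] = [seq [:: y] | y <- N x].
  by elim: (N x) => //= y s ->.
apply/eqP; rewrite -all_count; apply/allP => _ /mapP[y yN ->] /=.
by rewrite inE andbT; apply: contraTneq yN => ->; rewrite mem_N ei.
Qed.

Lemma sigma_exp D x n : (forall y, sigma y 1 <= D) -> sigma x n <= D ^ n.
Proof.
move=> H; elim: n x => [//|n IH] x.
rewrite -add1n expnD expn1 (leq_trans (sigma_add _ _ IH))//.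
by rewrite leq_mul2r H orbT.
Qed.

Lemma sigma_le_inj (f : T -> T) x n : injective f ->
  (forall a b, e (f a) (f b) = e a b) -> sigma x n <= sigma (f x) n.
Proof.
move=> fi fe; rewrite /sigma -(size_map (map f)).
apply: uniq_leq_size; first by rewrite map_inj_uniq ?saws_uniq//; exact: inj_map.
move=> p /mapP[q]; rewrite mem_saws => /and3P[sq pq uq] ->.
rewrite mem_saws size_map sq path_map -map_cons (map_inj_uniq fi) uq andbT.
by rewrite (@eq_path _ _ e).
Qed.

Lemma sigma_aut (f : T -> T) x n : bijective f ->
  (forall a b, e (f a) (f b) = e a b) -> sigma (f x) n = sigma x n.
Proof.
move=> [g fK gK] fe; apply/eqP; rewrite eqn_leq (sigma_le_inj _ _ (can_inj fK))//.
rewrite -{2}(fK x) (@sigma_le_inj g)//; first exact: can_inj gK.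
by move=> a b; rewrite -fe !gK.
Qed.

(* A walk from [u] either avoids [v], and can be started from [v] instead, or
   is split by [v] into two walks from [v]. *)
Lemma sigma_neighbour u v n : symmetric e -> irreflexive e -> e u v ->
  sigma u n <= sigma v n.+1 + \sum_(j < n.+1) sigma v j * sigma v (n - j).
Proof.
move=> es ei euv.
pose L := [seq behead q | q <- saws v n.+1] ++
  flatten [seq [seq behead (rev q) ++ v :: r | q <- saws v j, r <- saws v (n - j)]
             | j : 'I_n.+1 <- index_enum 'I_n.+1].
have -> : sigma v n.+1 + \sum_(j < n.+1) sigma v j * sigma v (n - j) = size L.
  rewrite size_cat size_map size_flatten /shape -map_comp sumnE big_map.
  by congr (_ + _); apply: eq_bigr => j _ /=; rewrite size_allpairs.
apply: uniq_leq_size; first exact: saws_uniq.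
move=> p; rewrite mem_saws => /and3P[/eqP sp pp up]; rewrite mem_cat.
have [vp|vp] := boolP (v \in p); last first.
  apply/orP; left; apply/mapP; exists (u :: p) => //.
  rewrite mem_saws /= sp eqxx es euv pp /= inE negb_or vp andbT -/(uniq (u :: p)) up.
  by rewrite andbT; apply: contraTneq euv => ->; rewrite ei.
apply/orP; right.
case/splitPr: vp sp pp up => p1 p2 sp pp up.
have jn : size p1 < n by rewrite -sp size_cat /=; lia.
have jn' : (size p1).+1 < n.+1 by [].
apply/flatten_mapP; exists (Ordinal jn') => /=; first by rewrite mem_index_enum.
(* The part before [v], read backwards with [u] appended, is a walk from [v] ending at [u]. *)
apply/allpairsP; exists (rev (u :: p1), p2); split=> /=; last by rewrite revK.
  rewrite mem_saws size_rev eqxx /=; apply/andP; split.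
    rewrite -(belast_rcons u p1 v) -{1}(last_rcons u p1 v) rev_path.
    rewrite (@eq_path _ _ e); last by move=> a b; exact: es.
    by move: pp; rewrite -cat_rcons cat_path => /andP[].
  rewrite mem_rev rev_uniq.
  by move: up; rewrite -cat_cons cat_uniq => /and3P[-> /= /norP[-> _] _].
rewrite mem_saws; apply/and3P; split.
- by rewrite -sp size_cat /=; apply/eqP; lia.
- by move: pp; rewrite cat_path /= => /and3P[].
- by move: up; rewrite -cat_cons cat_uniq => /and3P[].
Qed.

(** An initial piece of a self-avoiding walk is self-avoiding. If no walk from [x] had [n] steps,
    every vertex would be the end of one of the finitely many shorter ones. *)
Lemma sigma_gt0 x n : infinite_graph T -> graph_connected e -> 0 < sigma x n.
Proof.
move=> inf conn; rewrite lt0n; apply/negP => /eqP s0; apply: inf.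
apply: (@sub_finite_set _ _ [set` flatten [seq [seq last x p | p <- saws x m] | m <- iota 0 n]]).
  move=> y _ /=; have [p [pp <-]] := conn x y.
  case/shortenP: pp => q pq uq _.
  have [nq|qn] := leqP n (size q).
    suff : take n q \in saws x n by rewrite (size0nil s0).
    rewrite mem_saws size_takel// eqxx take_path//=.
    move: uq => /= /andP[xq uq]; rewrite take_uniq// andbT.
    by apply: contra xq; exact: mem_take.
  apply/flatten_mapP; exists (size q); first by rewrite mem_iota.
  by apply: map_f; rewrite mem_saws eqxx pq.
exact: finite_seq.
Qed.

End SawCounting.

(** * Exponential growth rates *)

Section Rates.
Variable R : realType.
Implicit Types (M : R) (s : nat -> nat).

Lemma powR_invnK (a : R) n : 0 <= a -> (0 < n)%N -> (a `^ n%:R^-1) ^+ n = a.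
Proof.
move=> a0 n0; rewrite -powR_mulrn ?powR_ge0// -powRrM mulVf ?powRr1//.
by rewrite pnatr_eq0 -lt0n.
Qed.

(** Supplies the slack [r] of the rate estimates: [Q] is the available ratio of two rates and [n]
    the number of factors [r] lost per step. *)
Lemma root_between (Q : R) n : 1 < Q -> exists2 r, 1 < r & r ^+ n <= Q.
Proof.
move=> Q1; have Q0 : 0 <= Q by lra.
(* The root of order [n.+1] rather than [n] also covers [n = 0]. *)
have e := @powR_invnK Q n.+1 Q0 isT.
have r1 : 1 < Q `^ n.+1%:R^-1.
  by rewrite -(@expr_gt1 _ n.+1) ?powR_ge0// e.
exists (Q `^ n.+1%:R^-1) => //.
by rewrite -[leRHS]e exprS ler_peMl ?exprn_ge0 ?powR_ge0// ltW.
Qed.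

Lemma linear_geometric (r : R) : 1 < r ->
  exists2 C, 0 < C & forall n, n.+1%:R <= C * r ^+ n.
Proof.
move=> r1; have d0 : 0 < r - 1 by lra.
have i0 : 0 < (r - 1)^-1 by rewrite invr_gt0.
(* With this constant, passing from [n] to [n.+1] raises the right side by exactly [r ^+ n.+1],
   which is at least 1. *)
exists (1 + (r - 1)^-1); first lra.
elim=> [|n IH]; first by rewrite expr0; lra.
have rn : 1 <= r ^+ n by apply: exprn_ege1; lra.
have -> : (1 + (r - 1)^-1) * r ^+ n.+1 = (1 + (r - 1)^-1) * r ^+ n + r * r ^+ n.
  by rewrite exprS; field; lra.
rewrite -[n.+2]addn1 natrD lerD//; nra.
Qed.

Lemma geometric_dominates (C y z : R) : 0 < y -> y < z ->
  exists n0, forall n, (n0 <= n)%N -> C * y ^+ n <= z ^+ n.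
Proof.
move=> y0 yz; have r1 : 1 < z / y by rewrite ltr_pdivlMr// mul1r.
have [B B0 HB] := linear_geometric r1.
exists (Num.truncn `|C * B|) => n n0n.
have /(le_lt_trans (ler_norm _)) CB := truncnS_gt `|C * B|.
have CBn : C * B <= n.+1%:R.
  by apply/ltW/(lt_le_trans CB); rewrite ler_nat.
have := le_trans CBn (HB n); rewrite mulrC ler_pM2l// expr_div_n.
by rewrite ler_pdivlMr// exprn_gt0.
Qed.

(** The constant is uniform over vertices, so that the tail of a walk can be bounded wherever it
    starts. The lower rate below concerns a single vertex. *)
Definition upper_rate (T : Type) (s : T -> nat -> nat) M :=
  forall y, M < y -> exists2 C, 0 < C & forall x n, (s x n)%:R <= C * y ^+ n.

Definition lower_rate s M :=
  forall y, 0 < y < M -> exists2 c, 0 < c & forall n, c * y ^+ n <= (s n)%:R.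

Lemma rate_cvg (T : Type) (s : T -> nat -> nat) x M : 0 < M ->
  upper_rate s M -> lower_rate (s x) M ->
  (fun n : nat => (s x n)%:R `^ (n%:R)^-1) @ \oo --> M.
Proof.
move=> M0 up lo; apply/cvgrPdist_le => eps eps0.
have [C C0 HC] : exists2 C, 0 < C &
    forall x n, (s x n)%:R <= C * (M + eps / 2) ^+ n.
  by apply: up; lra.
(* The maximum keeps the lower bound positive when [eps] exceeds [M]. *)
pose z := Num.max (M - eps) (M / 2).
have zM : z < M by rewrite /z; case: (leP (M - eps) (M/2)) => ?; lra.
have z0 : 0 < z by rewrite /z; case: (leP (M - eps) (M/2)) => ?; lra.
have zeps : M - eps <= z by rewrite le_max lexx.
have [c c0 Hc] := lo ((z + M) / 2) ltac:(lra).
have [n1 H1] := @geometric_dominates C (M + eps / 2) (M + eps) ltac:(lra) ltac:(lra).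
have [n2 H2] := @geometric_dominates c^-1 z ((z + M) / 2) ltac:(lra) ltac:(lra).
exists (maxn 1 (maxn n1 n2)) => // n /=; rewrite !geq_max => /and3P[n0 nn1 nn2].
have e : ((s x n)%:R `^ n%:R^-1 : R) ^+ n = (s x n)%:R by rewrite powR_invnK.
have r0 : 0 <= ((s x n)%:R `^ n%:R^-1 : R) by exact: powR_ge0.
have ub : (s x n)%:R `^ n%:R^-1 <= M + eps.
  rewrite -(@ler_pXn2r _ n)// ?nnegrE ?e//; last lra.
  exact: le_trans (HC x n) (H1 n nn1).
have lb : z <= (s x n)%:R `^ n%:R^-1.
  rewrite -(@ler_pXn2r _ n)// ?nnegrE ?e//; last exact: ltW.
  by apply: le_trans (Hc n); rewrite -ler_pdivrMl// H2.
by rewrite ler_norml; apply/andP; split; lra.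
Qed.

(** * Growth rates of self-avoiding walks *)

Section Graph.
Variables (T : eqType) (e : rel T) (N : T -> seq T).
Hypothesis N_uniq : forall x, uniq (N x).
Hypothesis mem_N : forall x y, (y \in N x) = e x y.
Local Notation sigma := (sigma N).

Lemma count_saws_cutr (A : pred (seq T)) x j n (t : R) : 0 <= t ->
  (forall q, q \in saws N x j -> A q -> (sigma (last x q) n)%:R <= t) ->
  (count (fun p => A (take j p)) (saws N x (j + n)))%:R <=
    (count A (saws N x j))%:R * t.
Proof.
(* Walk counts are integers, so [t] may be replaced by its integer part. *)
move=> t0 H; apply: (@le_trans _ _ (count A (saws N x j) * Num.truncn t)%:R).
  rewrite ler_nat; apply: (count_saws_cut N_uniq mem_N) => q qs Aq.
  by rewrite truncn_ge_nat// H.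
by rewrite natrM ler_wpM2l// truncn_le.
Qed.

Lemma sigma_addr x j n (t : R) : (forall y, (sigma y n)%:R <= t) ->
  (sigma x (j + n))%:R <= (sigma x j)%:R * t.
Proof.
move=> H; have t0 : 0 <= t by exact: le_trans (H x).
have := @count_saws_cutr predT x j n t t0 (fun q _ _ => H _).
by rewrite !count_predT.
Qed.

Section FinitelyManyTypes.
(** The form in which quasi-transitivity is used: finitely many vertices represent all walk-count
    sequences. *)
Variable W : seq T.
Hypothesis W_types : forall x, exists2 w, w \in W & forall n, sigma x n = sigma w n.

Lemma sigma_bounded n : exists S, forall x, (sigma x n <= S)%N.
Proof.
exists (\max_(w <- W) sigma w n) => x; have [w wW ->] := W_types x.
exact: (@leq_bigmax_seq _ W predT (sigma^~ n) w).
Qed.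

Lemma sigma_initial_bound K (y : R) : 0 < y -> exists2 C, 0 < C &
  forall r, (r < K)%N -> forall x, (sigma x r)%:R <= C * y ^+ r.
Proof.
move=> y0; have /choice[S HS] := sigma_bounded.
have p0 r : 0 <= (S r)%:R / y ^+ r by rewrite divr_ge0// exprn_ge0// ltW.
exists (1 + \sum_(r < K) (S r)%:R / y ^+ r).
  by rewrite ltr_pwDl// sumr_ge0.
move=> r rK x; rewrite -ler_pdivrMr ?exprn_gt0//.
rewrite (bigD1 (Ordinal rK))//= addrCA.
apply: (@le_trans _ _ ((S r)%:R / y ^+ r)).
  by rewrite ler_wpM2r ?invr_ge0 ?exprn_ge0 ?(ltW y0)// ler_nat.
by rewrite lerDl addr_ge0// sumr_ge0.
Qed.

(* A long walk is cut into pieces whose lengths satisfy the hypothesis. *)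
Lemma growth_of_pieces K (y : R) : 0 < y ->
  (forall x, exists2 n, (0 < n <= K)%N & (sigma x n)%:R <= y ^+ n) ->
  exists2 C, 0 < C & forall x n, (sigma x n)%:R <= C * y ^+ n.
Proof.
move=> y0 H; have [C C0 HC] := sigma_initial_bound K y0.
exists C => // x n; elim/ltn_ind: n x => n IH x.
have [nK|Kn] := ltnP n K; first exact: HC.
have [m /andP[m0 mK] Hm] := H x.
have -> : n = (m + (n - m))%N by lia.
apply: le_trans (sigma_addr x m (IH (n - m)%N _)) _; first by lia.
by rewrite exprD mulrCA ler_wpM2l ?(ltW C0)// ler_wpM2r// exprn_ge0 ?ltW.
Qed.

(** The rate is the infimum of the [y] for which some [n] satisfies [sigma x n <= y ^+ n] at all
    vertices at once. If every vertex violated the lower rate, each would have a short piece of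
    growth below the infimum; concatenating such pieces contradicts minimality. *)
Lemma growth_rate_exists : T -> (forall x n, 0 < sigma x n)%N ->
  exists M, [/\ 1 <= M, upper_rate sigma M & exists x, lower_rate (sigma x) M].
Proof.
move=> x0 pos.
pose A := [set y : R | 0 < y /\
  exists2 n, (0 < n)%N & forall x, (sigma x n)%:R <= y ^+ n].
have A1 y : A y -> 1 <= y.
  move=> [y0 [n n0 /(_ x0) Hy]]; rewrite -(@expr_ge1 _ n _ n0 (ltW y0)).
  by rewrite (le_trans _ Hy)// ler1n.
have lbA : has_lbound A by exists 1.
have neA : A !=set0.
  have [S HS] := sigma_bounded 1; exists (1 + S%:R); split; first exact: ltr_pwDl.
  by exists 1%N => // x; rewrite expr1 (@le_trans _ _ S%:R) ?ler_nat// lerDr.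
have M1 : 1 <= inf A by exact: lb_le_inf.
have M0 : 0 < inf A by lra.
exists (inf A); split=> //.
  move=> y /(inf_lt neA)[z [z0 [n n0 Hz]] zy].
  have [||C C0 HC] := @growth_of_pieces n z => //.
    by move=> x; exists n => //; rewrite n0 leqnn.
  exists C => // x m; apply: le_trans (HC x m) _.
  by rewrite (ler_wpM2l (ltW C0))// lerXn2r ?nnegrE ?(ltW zy)// ltW// (lt_trans z0).
apply: contrapT => nlow.
have : forall x, exists y, 0 < y < inf A /\ exists2 n, (0 < n)%N & (sigma x n)%:R <= y ^+ n.
  move=> x; apply: contrapT => nx; apply: nlow; exists x => y yM.
  exists 1 => // n; rewrite mul1r leNgt; apply/negP => lt.
  apply: nx; exists y; split=> //; exists n; last exact: ltW.
  (* The violating length is positive, since the two sides agree at length 0. *)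
  by case: n lt => //; rewrite expr0 sigma0 ltxx.
move=> /choice[Y HY].
have /choice[nu Hnu] : forall x, exists n, (0 < n)%N /\ (sigma x n)%:R <= Y x ^+ n.
  by move=> x; have [_ [n n0 Hn]] := HY x; exists n.
(* Having finitely many types gives one [y] that stays strictly below the infimum. *)
have [y /andP[y0 yM] Yy] : exists2 y, 0 < y < inf A & {in W, forall w, Y w <= y}.
  elim: (W) => [|w s [y /andP[y0 yM] Hy]]; first by exists (inf A / 2) => //; lra.
  have [/andP[Yw0 YwM] _] := HY w.
  exists (Num.max (Y w) y); first by rewrite lt_max y0 orbT gt_max YwM yM.
  move=> v; rewrite inE => /predU1P[->|/Hy vy]; first by rewrite le_max lexx.
  by rewrite le_max vy orbT.
have [||C C0 HC] := @growth_of_pieces (\max_(w <- W) nu w) y => //.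
  move=> x; have [w wW xw] := W_types x; have [nw Hw] := Hnu w.
  have [/andP[Yw0 _] _] := HY w.
  exists (nu w); first by rewrite nw (@leq_bigmax_seq _ W predT nu w).
  rewrite xw (le_trans Hw)// lerXn2r ?nnegrE ?Yy//; exact: ltW.
(* The midpoint is still below the infimum, and its excess over [y] absorbs [C] for long walks. *)
have [n0 Hn0] := @geometric_dominates C y ((y + inf A) / 2) y0 ltac:(lra).
suff : inf A <= (y + inf A) / 2 by lra.
apply: ge_inf => //; split; first by lra.
exists n0.+1 => // x; apply: le_trans (HC x _) _; exact: Hn0.
Qed.

End FinitelyManyTypes.

(** Apply [sigma_neighbour] to walks of length [n + n]: every product on the right has a factor of
    length at least [n]. Its first [n] steps contribute [sigma v n] and everything else obeys the
    upper rate, so a lower bound at [u] forces one at [v]. *)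
Lemma lower_rate_neighbour M u v : symmetric e -> irreflexive e -> e u v ->
  0 < M -> upper_rate sigma M -> lower_rate (sigma u) M -> lower_rate (sigma v) M.
Proof.
move=> es ei euv M0 up lo y /andP[y0 yM].
(* Four factors [r] are lost per step: two from the lower rate [M / r] at length [n + n], one from
   the upper rate [M * r], one from the linear number of terms. *)
have [r r1 Hr] := @root_between (M / y) 4 ltac:(by rewrite ltr_pdivlMr// mul1r).
have r0 : 0 < r by lra.
have Mr : M < M * r by rewrite ltr_pMr.
have [C C0 HC] := up _ Mr.
have [c c0 Hc] := lo (M / r) ltac:(by rewrite divr_gt0//= ltr_pdivrMr).
have [L L0 HL] := linear_geometric r1.
pose K := (C * (M * r) + 2 * C ^+ 2) * L.
have K0 : 0 < K by rewrite /K; do ?[apply: mulr_gt0|apply: addr_gt0|apply: exprn_gt0|lra].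
exists (c / K); first exact: divr_gt0.
move=> n; set s := (sigma v n)%:R.
have s0 : 0 <= s by [].
have q0 k : 0 <= (M * r) ^+ k by apply: exprn_ge0; nra.
have tail k : (sigma v (n + k))%:R <= s * (C * (M * r) ^+ k).
  by apply: sigma_addr => x; exact: HC.
have term (j : 'I_(n + n).+1) :
    (sigma v j * sigma v (n + n - j))%:R <= s * (C ^+ 2 * (M * r) ^+ n).
  (* Here [b] is the longer length; it is cut after [n] steps. *)
  have aux a b : (a <= n)%N -> (a + b = n + n)%N ->
      (sigma v a * sigma v b)%:R <= s * (C ^+ 2 * (M * r) ^+ n).
    move=> an ab; rewrite natrM.
    have -> : b = (n + (n - a))%N by clear -an ab; lia.
    apply: (@le_trans _ _ (C * (M * r) ^+ a * (s * (C * (M * r) ^+ (n - a))))).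
      by apply: ler_pM => //; exact: HC.
    rewrite -{2}(subnKC an) exprD le_eqVlt; apply/orP; left; apply/eqP; ring.
  have jn := ltn_ord j.
  have [jn'|jn'] := leqP j n; first by apply: aux; clear -jn jn'; lia.
  by rewrite mulnC; apply: aux; clear -jn jn'; lia.
have main : c * (M / r) ^+ (n + n) <= s * ((M * r) ^+ n * (K * r ^+ n)).
  apply: le_trans (Hc _) _.
  apply: le_trans (_ : _ <= s * (C * (M * r) ^+ n.+1) +
      (n + n).+1%:R * (s * (C ^+ 2 * (M * r) ^+ n))) _.
    have := sigma_neighbour N_uniq mem_N (n + n) es ei euv.
    rewrite -(ler_nat R) => /le_trans; apply.
    rewrite natrD lerD//; first by rewrite -addnS; exact: tail.
    rewrite natr_sum (le_trans (ler_sum _ (fun j _ => term j)))//.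
    by rewrite sumr_const card_ord mulr_natl.
  have n1 := HL n.
  have n2 : (n + n).+1%:R <= 2 * (L * r ^+ n).
    apply: le_trans (_ : _ <= 2 * n.+1%:R) _; last by rewrite ler_pM2l.
    by rewrite -natrM ler_nat; clear; lia.
  have n3 : 1 <= L * r ^+ n by apply: le_trans n1; rewrite ler1n.
  have w0 : 0 <= s * (M * r) ^+ n by rewrite mulr_ge0.
  have -> : s * ((M * r) ^+ n * (K * r ^+ n)) = s * (M * r) ^+ n * (C * (M * r)) * (L * r ^+ n)
     + (2 * (L * r ^+ n)) * (s * (C ^+ 2 * (M * r) ^+ n)) by rewrite /K; ring.
  apply: lerD.
    rewrite exprS; have -> : s * (C * (M * r * (M * r) ^+ n)) = s * (M * r) ^+ n * (C * (M * r)) by ring.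
    by rewrite ler_peMr// mulr_ge0//; nra.
  by rewrite ler_wpM2r// !mulr_ge0// ?exprn_ge0// ltW.
have y4 : y <= M / r ^+ 4.
  by rewrite ler_pdivlMr ?exprn_gt0// mulrC -ler_pdivlMr.
apply: le_trans (_ : c / K * (M / r ^+ 4) ^+ n <= _).
  apply: ler_wpM2l; first by rewrite divr_ge0// ltW.
  by apply: lerXn2r => //; rewrite nnegrE ?divr_ge0 ?exprn_ge0// ltW.
rewrite mulrAC ler_pdivrMr//.
have d0 : 0 < (M * r) ^+ n * r ^+ n by rewrite mulr_gt0// exprn_gt0// mulr_gt0.
rewrite -(ler_pM2r d0).
have -> : c * (M / r ^+ 4) ^+ n * ((M * r) ^+ n * r ^+ n) = c * (M / r) ^+ (n + n).
  rewrite -mulrA -!exprMn exprD -exprMn; congr (_ * _ ^+ _); field.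
  by rewrite gt_eqF.
by apply: le_trans main _; rewrite le_eqVlt; apply/orP; left; apply/eqP; ring.
Qed.

Lemma lower_rate_connected M u v : symmetric e -> irreflexive e ->
  graph_connected e -> 0 < M -> upper_rate sigma M ->
  lower_rate (sigma u) M -> lower_rate (sigma v) M.
Proof.
move=> es ei conn M0 up; have [p [pp <-]] := conn u v.
elim: p u pp => [//|x p IH] u /= /andP[ux xp] lo; apply: IH => //.
exact: lower_rate_neighbour lo.
Qed.

Lemma connective_constant_rate M x : symmetric e -> irreflexive e ->
  graph_connected e -> 0 < M -> upper_rate sigma M ->
  lower_rate (sigma x) M -> connective_constant e M.
Proof.
move=> es ei conn M0 up lo v; exists (sigma v); split.
  by move=> n; exact: saw_count_sigma.
by apply: rate_cvg => //; exact: lower_rate_connected lo.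
Qed.

End Graph.
End Rates.

(** * Gadget series *)

Section GadgetPaths.
Variables (K : finType) (gadj : rel K).

(** Arbitrary ends are allowed so that traversals between any two ports can be compared;
    [gadget_saw] is the case of the ports [w ord0] and [w port1]. *)
Definition gpath (a b : K) (q : seq K) : bool :=
  if q is x :: q' then
    [&& x == a, path gadj x q', uniq q & last x q' == b]
  else false.

Definition gpaths (a b : K) : seq (seq K) :=
  flatten [seq [seq val t | t : n.-tuple K <- enum {: n.-tuple K} & gpath a b t]
             | n <- iota 0 #|K|.+1].

Lemma mem_gpaths a b q : (q \in gpaths a b) = gpath a b q.
Proof.
apply/flatten_mapP/idP => [[n _ /mapP[t]]|qab].
  by rewrite mem_filter => /andP[? _] ->.
exists (size q).
  rewrite mem_iota add0n ltnS cardE.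
  have /uniq_leq_size : uniq q by case: q qab => //= x q /and4P[].
  by apply=> x _; rewrite mem_enum.
by apply/mapP; exists (in_tuple q) => //; rewrite mem_filter qab mem_enum.
Qed.

Lemma gpaths_uniq a b : uniq (gpaths a b).
Proof.
have -> : gpaths a b = [seq t | n <- iota 0 #|K|.+1,
    t <- [seq val t | t : n.-tuple K <- enum {: n.-tuple K} & gpath a b t]].
  by congr flatten; apply: eq_map => n; rewrite map_id.
apply: allpairs_uniq_dep; first exact: iota_uniq.
  by move=> n _; rewrite (map_inj_uniq val_inj) filter_uniq// enum_uniq.
move=> p1 p2 /allpairsPdep[n [q1 [_ /mapP[t _ ->] ->]]].
move=> /allpairsPdep[m [q2 [_ /mapP[t' _ ->] ->]]] /= tt'.
have nm : n = m by rewrite -[n](size_tuple t) -[m](size_tuple t') tt'.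
by case: _ / nm t' tt' => t' ->.
Qed.

Variable R : comPzRingType.

Definition gsum a b (x : R) : R :=
  \sum_(n < #|K|.+1) \sum_(t : n.-tuple K | gpath a b t) x ^+ n.

Lemma sum_gpaths a b (x : R) : \sum_(q <- gpaths a b) x ^+ size q = gsum a b x.
Proof.
rewrite big_flatten big_map -{1}[#|K|.+1]subn0 -/(index_iota _ _) big_mkord.
apply: eq_bigr => n _; rewrite big_map big_filter big_enum_cond/=.
by apply: eq_bigr => t _; rewrite size_tuple.
Qed.

Lemma gsum_aut (f : {perm K}) a b x : f \in gadget_aut gadj ->
  gsum (f a) (f b) x = gsum a b x.
Proof.
rewrite inE => /forallP fP.
have fadj c d : gadj (f c) (f d) = gadj c d by have /forallP/(_ d)/eqP := fP c.
have fK n : cancel (map_tuple f : n.-tuple K -> n.-tuple K) (map_tuple (f^-1)%g).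
  by move=> t; apply: val_inj; rewrite /= -map_comp map_id_in// => c _ /=; rewrite permK.
have Kf n : cancel (map_tuple (f^-1)%g : n.-tuple K -> n.-tuple K) (map_tuple f).
  by move=> t; apply: val_inj; rewrite /= -map_comp map_id_in// => c _ /=; rewrite permKV.
apply: eq_bigr => n _; rewrite (reindex (map_tuple f)) /=; last first.
  by exists (map_tuple (f^-1)%g) => t _; [exact: fK|exact: Kf].
apply: eq_bigl => t; case: (val t) => [//|c q] /=.
rewrite (inj_eq perm_inj) path_map (mem_map perm_inj) (map_inj_uniq perm_inj).
rewrite last_map (inj_eq perm_inj); congr [&& _, _, _ & _].
by apply: eq_path => ? ?; exact: fadj.
Qed.

Lemma gsum_sym a b x : symmetric gadj -> gsum a b x = gsum b a x.
Proof.
move=> gs.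
have revK' n : involutive (fun t : n.-tuple K => [tuple of rev t]).
  by move=> t; apply: val_inj; rewrite /= revK.
apply: eq_bigr => n _; rewrite (reindex_inj (inv_inj (revK' n))) /=.
apply: eq_bigl => t; move: (val t) => {}t; case: t => [//|c q].
case/lastP: q => [|q d]; first by rewrite /gpath /= andbC.
have -> : rev (c :: rcons q d) = d :: rcons (rev q) c.
  by rewrite -rcons_cons rev_rcons rev_cons.
have pr : path gadj d (rcons (rev q) c) = path gadj c (rcons q d).
  rewrite -rev_cons -(belast_rcons c q d) -{1}(last_rcons c q d) rev_path.
  by apply: eq_path => ? ?; exact: gs.
have ur : uniq (d :: rcons (rev q) c) = uniq (c :: rcons q d).
  by rewrite -rev_cons -rev_rcons rev_uniq.
rewrite /gpath pr ur !last_rcons.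
by case: (d == a); case: (c == b); rewrite ?andbT ?andbF.
Qed.

End GadgetPaths.

Section GadgetSymmetry.
Variables (K : finType) (gadj : rel K) (w : 'I_3 -> K).
Variable R : comPzRingType.

(** Addition in ['I_3] is modulo 3, so an unordered pair of ports can be labelled by the omitted
    index [k]. *)
Lemma ord3_complement (i j k : 'I_3) : i != j -> i != k -> j != k ->
  (i, j) = (k + 1, k + 2%:R) \/ (i, j) = (k + 2%:R, k + 1).
Proof.
have H (a b : 'I_3) : (a : nat) = b -> a = b by exact: val_inj.
case: i => [[|[|[|//]]] hi]; case: j => [[|[|[|//]]] hj];
  case: k => [[|[|[|//]]] hk] //= _ _ _;
  by [left; congr pair; apply: H | right; congr pair; apply: H].
Qed.

(* The sum over a pair of ports is labelled by the third port, and the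
   automorphism group acts transitively on these labels. *)
Lemma gsum_ports i j (x : R) : valid_gadget gadj w -> i != j ->
  gsum gadj (w i) (w j) x = gadget_series gadj w x.
Proof.
move=> [[gs _] _ winj [H [Haut Hacts Htrans]]].
pose E k := gsum gadj (w (k + 1)) (w (k + 2%:R)) x.
have EE a b k : a != b -> a != k -> b != k -> gsum gadj (w a) (w b) x = E k.
  move=> ab ak bk; have [[-> ->]|[-> ->]] := ord3_complement ab ak bk; first by [].
  exact: gsum_sym.
have third (a b : 'I_3) : a != b -> exists k, a != k /\ b != k.
  case: a => [[|[|[|//]]] ha]; case: b => [[|[|[|//]]] hb] //= _;
    by [exists (@Ordinal 3 0 isT)|exists (@Ordinal 3 1 isT)|exists (@Ordinal 3 2 isT)].
have portP k : w k \in ports w by exact: imset_f.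
have Ek k l : E k = E l.
  have : w l \in orbit 'P H (w k) by rewrite (atransP Htrans).
  move=> /imsetP[f fH /= wl].
  have fports c : exists d, f (w c) = w d.
    have := acts_act Hacts fH (w c); rewrite portP => /imsetP[d _ fd].
    by exists d.
  have wl' : f (w k) = w l by rewrite wl.
  (* Since [f] permutes the ports and sends [w k] to [w l], it carries the other two ports to the
     two other than [w l], in some order. *)
  have [c fc] := fports (k + 1); have [d fd] := fports (k + 2%:R).
  rewrite /E -(@gsum_aut _ _ _ f) ?(fintype.subsetP Haut)// fc fd.
  have neq (a b a' b' : 'I_3) : a != b -> f (w a) = w a' -> f (w b) = w b' -> a' != b'.
    move=> ab fa fb; apply: contra_neq ab => ab'; apply/winj/(@perm_inj _ f).
    by rewrite fa fb ab'.
  have kn : [/\ k + 1 != k + 2%:R, k + 1 != k & k + 2%:R != k].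
    by move: {fc fd wl wl'} k => [[|[|[|//]]] hk].
  have [k12 k1 k2] := kn.
  by apply: EE; [apply: neq fc fd|apply: neq fc wl'|apply: neq fd wl'].
move=> ij.
have [k [ik jk]] := third i j ij.
rewrite (EE i j k)// (Ek k (2%:R : 'I_3)) -(EE (ord0 : 'I_3) port1)//.
Qed.

End GadgetSymmetry.

Section GadgetSeries.
Variables (K : finType) (gadj : rel K) (w : 'I_3 -> K) (R : realType).
Hypothesis valid : valid_gadget gadj w.
Local Notation series := (@gadget_series K gadj w R).

(** Connectedness of the gadget gives at least one traversal, hence one monomial of the series. *)
Lemma gadget_series_monomial : exists k, forall x : R, 0 <= x -> x ^+ k <= series x.
Proof.
have [_ conn _ _] := valid.
have /connectP[p pp lp] := conn (w ord0) (w port1).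
case/shortenP: pp lp => q pq uq _ lq.
exists (size (w ord0 :: q)) => x x0.
have qg : w ord0 :: q \in gpaths gadj (w ord0) (w port1).
  by rewrite mem_gpaths /= eqxx pq lq eqxx andbT.
rewrite -[series x]/(gsum gadj (w ord0) (w port1) x) -sum_gpaths (big_rem _ qg) /=.
by rewrite lerDl sumr_ge0// => r _; exact: exprn_ge0.
Qed.

Lemma gadget_series_gt0 (x : R) : 0 < x -> 0 < series x.
Proof.
have [k Hk] := gadget_series_monomial => x0.
by apply: lt_le_trans (Hk x (ltW x0)); exact: exprn_gt0.
Qed.

Lemma ler_gadget_series (x y : R) : 0 <= x -> x <= y -> series x <= series y.
Proof.
move=> x0 xy; apply: ler_sum => n _; apply: ler_sum => t _.
by apply: lerXn2r => //; rewrite nnegrE// (le_trans x0).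
Qed.

Lemma h_lt (x y : R) : 0 < x -> x < y -> x * series x < y * series y.
Proof.
move=> x0 xy; have y0 := lt_trans x0 xy.
apply: le_lt_trans (_ : _ <= x * series y) _.
  by apply: ler_wpM2l; [exact: ltW|apply: ler_gadget_series; exact: ltW].
by rewrite ltr_pM2r// gadget_series_gt0.
Qed.

(** The intermediate value theorem applies: [h] vanishes at 0 and is at least 1 at 1. *)
Lemma h_surj (c : R) : 0 < c <= 1 ->
  exists x : R, [/\ 0 < x, x <= 1 & x * series x = c].
Proof.
move=> /andP[c0 c1].
(* Evaluating the series at the indeterminate turns [h] into a polynomial. *)
pose p : {poly R} := 'X * gadget_series gadj w 'X - c%:P.
have pE x : p.[x] = x * series x - c.
  rewrite /p !hornerE /gadget_series !horner_sum; congr (_ * _ - _).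
  apply: eq_bigr => n _; rewrite horner_sum; apply: eq_bigr => t _.
  by rewrite hornerXn.
have [||x /andP[x0 x1]] := @poly_ivt R p 0 1 => //.
  rewrite !pE !mul0r mul1r sub0r oppr_le0 (ltW c0) subr_ge0 (le_trans c1)//.
  by have [k /(_ 1 ler01)] := gadget_series_monomial; rewrite expr1n.
rewrite rootE pE subr_eq0 => /eqP xc; exists x; split=> //.
rewrite lt_neqAle x0 andbT; apply: contraTneq c0 => x00.
by rewrite -xc -x00 mul0r ltxx.
Qed.

End GadgetSeries.

(** * Lifting walks to the transformed graph *)

Lemma sum_const_seq (A : pzSemiRingType) (I : eqType) (s : seq I) (F : I -> A) c :
  {in s, forall i, F i = c} -> \sum_(i <- s) F i = (size s)%:R * c.
Proof.
elim: s => [|i s IH] H; first by rewrite big_nil mul0r.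
rewrite big_cons H ?mem_head// IH; first by rewrite /= mulrS mulrDl mul1r.
by move=> j js; apply: H; rewrite in_cons js orbT.
Qed.

Lemma ler_sum_subset (A : numDomainType) (I : eqType) (s1 s2 : seq I) (F : I -> A) :
  (forall i, 0 <= F i) -> uniq s1 -> {subset s1 <= s2} ->
  \sum_(i <- s1) F i <= \sum_(i <- s2) F i.
Proof.
move=> F0; elim: s1 s2 => [|i s IH] s2; first by rewrite big_nil sumr_ge0.
move=> /= /andP[si us] sub; rewrite (big_rem i) /= ?mem_head// eqxx.
rewrite [leRHS](big_rem i) /= ?sub ?mem_head// lerD2l IH// => j js.
have ji : j != i by apply: contraNneq si => <-.
have := sub j; rewrite in_cons js orbT => /(_ isT) js2.
by move: js2; rewrite (perm_mem (perm_to_rem (sub i (mem_head _ _)))) in_cons (negPf ji).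
Qed.

Section Lifts.
Variables (V : eqType) (adj : rel V) (chi : V -> bool).
Variables (K : finType) (gadj : rel K) (w : 'I_3 -> K) (nb : V -> 'I_3 -> V).
Hypothesis adj_sym : symmetric adj.
Hypothesis bip : bipartite_colouring adj chi.
Hypothesis att : attachment adj chi nb.
Hypothesis w_inj : injective w.

Local Notation white := {u : V | ~~ chi u}.
Local Notation black := {v : V | chi v}.
Local Notation tv := (tvert chi K).
Local Notation tadj := (tadj adj chi gadj w nb).

Definition is_white (z : tv) : bool := if z is inl _ then true else false.

Definition chunk (v : black) (q : seq K) : seq tv :=
  [seq (inr (v, a) : tv) | a <- q].

(** An even walk of [G] from a white vertex is encoded by its successive black-white pairs, with the
    starting vertex left out as in [path]. *)
Definition flat (p : seq (black * white)) : seq V :=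
  flatten [seq [:: val vu.1; val vu.2] | vu <- p].

(** The port of the gadget at [v] facing [u]. The default [ord0] is reached only when [u] is not a
    neighbour of [v]. *)
Definition port (v : black) (u : white) : K :=
  w (odflt ord0 [pick i | nb (val v) i == val u]).

Fixpoint lifts (u : white) (p : seq (black * white)) : seq (seq tv) :=
  if p is (v, u') :: p' then
    [seq chunk v q ++ (inl u' : tv) :: r
       | q <- gpaths gadj (port v u) (port v u'), r <- lifts u' p']
  else [:: [::]].

(* In a lift, a gadget vertex is followed by a white vertex exactly at the end of
   a gadget traversal. *)
Fixpoint erase (r : seq tv) : seq (black * white) :=
  if r is x :: r' then
    match x, r' with
    | inr (v, _), inl u :: _ => (v, u) :: erase r'
    | _, _ => erase r'
    end
  else [::].

Lemma nb_black (v : black) (u : V) : reflect (exists i, nb (val v) i = u) (adj (val v) u).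
Proof. by apply: (iffP idP) => [/(proj2 (att (valP v)) u)|/(proj2 (att (valP v)) u)]. Qed.

Lemma port_nb (v : black) (u : white) i : nb (val v) i = val u -> port v u = w i.
Proof.
move=> iu; rewrite /port; case: pickP => [j /eqP ju|/(_ i)]; last by rewrite iu eqxx.
by congr w; apply: (proj1 (att (valP v))); rewrite ju.
Qed.

Lemma tadj_white_black (u : white) (v : black) a :
  tadj (inl u) (inr (v, a)) = adj (val v) (val u) && (a == port v u).
Proof.
rewrite /= adj_sym; case: nb_black => [[i iu]|//] /=.
rewrite (port_nb iu); apply/existsP/eqP => [[j /andP[/eqP ju /eqP ->]]|->].
  by congr w; apply: (proj1 (att (valP v))); rewrite ju.
by exists i; rewrite iu !eqxx.
Qed.

Lemma tadj_black_white (u : white) (v : black) a :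
  tadj (inr (v, a)) (inl u) = adj (val v) (val u) && (a == port v u).
Proof. by rewrite -tadj_white_black. Qed.

Lemma port_inj (v : black) (u u' : white) : adj (val v) (val u) ->
  adj (val v) (val u') -> port v u = port v u' -> u = u'.
Proof.
move=> /nb_black[i iu] /nb_black[j ju]; rewrite (port_nb iu) (port_nb ju).
by move=> /w_inj ij; apply: val_inj; rewrite -iu -ju ij.
Qed.

Lemma port_index (v : black) (u : white) : exists i, port v u = w i.
Proof. by rewrite /port; eexists. Qed.

Lemma size_flat p : size (flat p) = (size p).*2.
Proof. by elim: p => //= vu p ->. Qed.

Lemma flat_surj (u : white) (p : seq V) k : path adj (val u) p -> size p = k.*2 ->
  exists p', flat p' = p.
Proof.
elim: k u p => [|k IH] u p; first by case: p => // _ _; exists [::].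
case: p => [//|v [//|u' p]] /= /and3P[uv vu' pp] [sp].
have bv : chi v by move: (bip uv) (valP u); case: (chi v) => //; rewrite eqbF_neg negbK => ->.
have wu : ~~ chi u' by move: (bip vu'); rewrite bv; case: (chi u').
have [p' <-] := IH (exist _ u' wu) p pp sp.
by exists ((exist _ v bv, exist _ u' wu) :: p').
Qed.

Lemma flat_inj : injective flat.
Proof.
elim=> [|[v u] p IH] [|[v' u'] p'] //= [/val_inj -> /val_inj -> /IH ->] //.
Qed.

Lemma mem_flat_white (u : white) p : (val u \in flat p) = (u \in [seq vu.2 | vu <- p]).
Proof.
elim: p => //= -[v u'] p IH; rewrite /flat /= !inE -/(flat p) IH.
have /negPf -> : val u != val v by apply: contraNneq (valP u) => ->; exact: valP.
by rewrite (inj_eq val_inj).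
Qed.

Lemma mem_flat_black (v : black) p : (val v \in flat p) = (v \in [seq vu.1 | vu <- p]).
Proof.
elim: p => //= -[v' u] p IH; rewrite /flat /= !inE -/(flat p) IH.
have /negPf -> : val v != val u by apply: contraNneq (valP u) => <-; exact: valP.
by rewrite (inj_eq val_inj).
Qed.

Lemma erase_cat v q u r : q != [::] ->
  erase (chunk v q ++ (inl u : tv) :: r) = (v, u) :: erase r.
Proof.
case: q => [//|a q] _; elim: q a => [|b q IH] a //=.
by rewrite -(IH b).
Qed.

Lemma gpath_neq0 a b q : gpath gadj a b q -> q != [::].
Proof. by case: q. Qed.

(** The base walk can be read off a lift, so different walks have disjoint sets of lifts. *)
Lemma erase_lifts u p r : r \in lifts u p -> erase r = p.
Proof.
elim: p u r => [|[v u'] p IH] u r /=; first by rewrite inE => /eqP ->.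
case/allpairsP=> -[q r'] /= []; rewrite mem_gpaths => /gpath_neq0 q0 /IH <- ->.
exact: erase_cat.
Qed.

Lemma chunk_cat_inj v q q' u r r' :
  chunk v q ++ (inl u : tv) :: r = chunk v q' ++ (inl u : tv) :: r' -> q = q' /\ r = r'.
Proof.
elim: q q' => [|a q IH] [|a' q'] //=; first by case.
by case=> -> /IH[-> ->].
Qed.

Lemma lifts_uniq u p : uniq (lifts u p).
Proof.
elim: p u => [//|[v u'] p IH] u /=; apply: allpairs_uniq; [exact: gpaths_uniq|exact: IH|].
by move=> [q r] [q' r'] _ _ /= /chunk_cat_inj[-> ->].
Qed.

(** The lower bound counts only the white vertices; the upper one uses that a traversal visits at
    most [#|K|] vertices. *)
Lemma lifts_size u p r : r \in lifts u p ->
  (size p <= size r <= #|K|.+1 * size p)%N.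
Proof.
elim: p u r => [|[v u'] p IH] u r /=; first by rewrite inE => /eqP ->.
case/allpairsP=> -[q r'] /= []; rewrite mem_gpaths => qq /IH/andP[h1 h2] ->.
have uq : uniq q by case: q qq => //= ? ? /and4P[].
have sq : (size q <= #|K|)%N.
  by rewrite cardE; apply: uniq_leq_size => // x _; rewrite mem_enum.
rewrite size_cat size_map /=; apply/andP; split.
  by rewrite addnS ltnS (leq_trans h1)// leq_addl.
by rewrite mulnS addnS -addSn leq_add.
Qed.

Lemma lifts_white u p r : r \in lifts u p ->
  forall u' : white, (inl u' : tv) \in r = (u' \in [seq vu.2 | vu <- p]).
Proof.
elim: p u r => [|[v u'] p IH] u r /=; first by rewrite inE => /eqP ->.
case/allpairsP=> -[q r'] /= [_ /IH h ->] u''.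
rewrite mem_cat inE in_cons h /=; case: mapP => [[a _]|_] //.
Qed.

Lemma lifts_black u p r : r \in lifts u p ->
  forall v a, (inr (v, a) : tv) \in r -> v \in [seq vu.1 | vu <- p].
Proof.
elim: p u r => [|[v u'] p IH] u r /=; first by rewrite inE => /eqP ->.
case/allpairsP=> -[q r'] /= [_ /IH h ->] v' a.
rewrite mem_cat inE in_cons /= => /orP[/mapP[b _ [-> _]]|/h ->]; first by rewrite eqxx.
by rewrite orbT.
Qed.

Lemma chunk_path v q a : path tadj (inr (v, a)) (chunk v q) = path gadj a q.
Proof. by elim: q a => //= b q IH a; rewrite eqxx /= IH. Qed.

Lemma last_chunk v q a : last (inr (v, a) : tv) (chunk v q) = inr (v, last a q).
Proof. by elim: q a => //=. Qed.

(** Gadgets at different black vertices are disjoint, so a repetition in the lift would project to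
    one in the base walk. *)
Lemma lifts_saw u p r : path adj (val u) (flat p) -> uniq (val u :: flat p) ->
  r \in lifts u p ->
  [/\ path tadj (inl u) r, uniq ((inl u : tv) :: r) & is_white (last (inl u) r)].
Proof.
elim: p u r => [|[v u'] p IH] u r; first by move=> _ _; rewrite inE => /eqP ->.
move=> pp uu /= /allpairsP[[q r'] /= [qq rr ->]].
move: pp; rewrite /flat /= -/(flat p) adj_sym => /and3P[vu vu' pp].
move: uu; rewrite /flat /= -/(flat p) !inE !negb_or => /and3P[/and3P[uv uu' up] /andP[vu'' vp] u'p].
have [pr ur lr] := IH u' r' pp u'p rr.
have wu : inl u \notin r' by rewrite (lifts_white rr) -mem_flat_white.
have bv a : inr (v, a) \notin r'.
  by apply: contra vp => /(lifts_black rr); rewrite mem_flat_black.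
rewrite mem_gpaths in qq; case: q qq => [//|a q] /= /and4P[/eqP -> pq uq /eqP lq].
split.
- rewrite cat_path chunk_path pq last_chunk lq /= pr andbT.
  have := tadj_white_black u v (port v u); rewrite vu eqxx /= => ->.
  by have := tadj_black_white u' v (port v u'); rewrite vu' eqxx /= => ->.
- have ninl (x : white) : (inl x : tv) \notin chunk v (port v u :: q) by apply/mapP => -[].
  suff : uniq ((inl u : tv) :: (chunk v (port v u :: q) ++ (inl u' : tv) :: r')) by [].
  rewrite cons_uniq cat_uniq mem_cat in_cons ur andbT.
  rewrite (negPf (ninl u)) (negPf wu) orbF; apply/and3P; split.
  + by apply: contra uu' => /eqP[->].
  + by rewrite map_inj_uniq// => ? ? [].
  + rewrite has_sym; apply/hasPn => z /mapP[b _ ->]; rewrite in_cons /=.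
    exact: bv.
- by rewrite last_cat.
Qed.

(** Splits off the part up to the first white vertex: a walk can leave a gadget only to a white
    vertex, through the port facing it. *)
Lemma parse_chunk v a r : path tadj (inr (v, a)) r ->
  is_white (last (inr (v, a)) r) ->
  exists q u' r', [/\ r = chunk v q ++ (inl u' : tv) :: r', path gadj a q,
    adj (val v) (val u'), last a q = port v u' & path tadj (inl u') r'].
Proof.
elim: r a => [//|[u'|[v' b]] r IH] a.
  rewrite /= -[X in X && _]/(tadj (inr (v, a)) (inl u')) tadj_black_white.
  by move=> /andP[/andP[vu' /eqP ap] pr] _; exists [::], u', r.
move=> /= /andP[/andP[/eqP <- ab] pr] /(IH _ pr)[q [u' [r' [-> pq vu' lq pr']]]].
by exists (b :: q), u', r'; rewrite /= ab.
Qed.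

(** The white vertices before and after [v] differ, so entrance and exit use different ports. *)
Lemma lifts_two_ports u p r v : path adj (val u) (flat p) ->
  uniq (val u :: flat p) -> r \in lifts u p -> v \in [seq vu.1 | vu <- p] ->
  exists i j, [/\ i != j, (inr (v, w i) : tv) \in r & (inr (v, w j) : tv) \in r].
Proof.
elim: p u r => [//|[v' u'] p IH] u r.
rewrite /flat /= -/(flat p) !inE adj_sym => /and3P[vu vu' pp] /and3P[/norP[_ /norP[uu' _]] _ up].
case/allpairsP => -[q r'] /= []; rewrite mem_gpaths => qq rr ->.
case/predU1P => [->|vp]; last first.
  have [i [j [ij ri rj]]] := IH _ _ pp up rr vp.
  by exists i, j; rewrite ij !mem_cat !inE ri rj !orbT.
have [i pi] := port_index v' u; have [j pj] := port_index v' u'.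
case: q qq => [//|a q] /= /and4P[/eqP ai _ _ /eqP lj].
exists i, j; split.
- apply: contra uu' => /eqP ij; apply/eqP; congr val.
  by apply: (port_inj vu vu'); rewrite pi pj ij.
- by rewrite -pi ai mem_head.
- rewrite -pj -lj -cat_cons mem_cat; apply/orP; left.
  by rewrite -[X in X \in _](last_chunk v' q a) mem_last.
Qed.

(* A second visit to the gadget at [v] would use two further ports, and there
   are only three. *)
Lemma white_saw_lift u r : path tadj (inl u) r -> uniq ((inl u : tv) :: r) ->
  is_white (last (inl u) r) ->
  [/\ path adj (val u) (flat (erase r)), uniq (val u :: flat (erase r))
    & r \in lifts u (erase r)].
Proof.
have [n] := ubnP (size r); elim: n u r => // n IH u [//|x r1].
rewrite ltnS => /= sr /andP[ux pr1] /andP[ur1 ur2] lr.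
case: x ux pr1 ur1 ur2 lr => [u1 //|[v a]] uva pr1 ur1 ur2 lr.
have /andP[vu /eqP ap] : adj (val v) (val u) && (a == port v u).
  by rewrite -tadj_white_black.
have [q [u' [r' [r1E pq vu' lq pr']]]] := parse_chunk pr1 lr.
have rE : (inr (v, a) : tv) :: r1 = chunk v (a :: q) ++ (inl u' : tv) :: r' by rewrite r1E.
rewrite -/(erase ((inr (v, a) : tv) :: r1)).
have uall : uniq ((inl u : tv) :: chunk v (a :: q) ++ (inl u' : tv) :: r').
  by rewrite -rE cons_uniq ur1.
move: uall; rewrite cons_uniq cat_uniq mem_cat in_cons.
case/andP=> /norP[_ /norP[uu' ur']] /and3P[uc dis u'r'].
have {}uu' : u != u' by apply: contra uu' => /eqP ->.
have lr' : is_white (last (inl u') r') by move: lr; rewrite r1E last_cat.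
have sr' : (size r' < n)%N.
  by apply: leq_trans sr; rewrite r1E size_cat ltnS (leq_trans (leqnSn _))// leq_addl.
have [pp up rp] := IH u' r' sr' pr' u'r' lr'.
have uaq : uniq (a :: q) by move: uc; rewrite map_inj_uniq// => ? ? [].
have vp : val v \notin flat (erase r').
  rewrite mem_flat_black; apply/negP => vp.
  have [i [j [ij ri rj]]] := lifts_two_ports pp up rp vp.
  have [k pk] := port_index v u; have [l pl] := port_index v u'.
  have kc : (inr (v, w k) : tv) \in chunk v (a :: q) by rewrite -pk -ap mem_head.
  have lc : (inr (v, w l) : tv) \in chunk v (a :: q).
    by rewrite -pl -lq -[X in X \in _](last_chunk v q a) mem_last.
  have kl : k != l.
    apply: contra uu' => /eqP kl; apply/eqP; apply: (port_inj vu vu').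
    by rewrite pk pl kl.
  have ne m m' : (inr (v, w m) : tv) \in r' -> (inr (v, w m') : tv) \in chunk v (a :: q) -> m != m'.
    move=> mr mc; apply: contra dis => /eqP mm; apply/hasP.
    by exists (inr (v, w m)); [rewrite in_cons mr orbT|rewrite mm].
  have := max_card (mem [:: i; j; k; l]).
  rewrite card_ord (card_uniqP _)//= !inE !negb_or ij kl.
  by rewrite !ne.
rewrite rE erase_cat//; split.
- by rewrite /flat /= -/(flat _) adj_sym vu vu'.
- rewrite /flat /= -/(flat _) !inE !negb_or vp.
  have -> : val u != val v by apply: contraNneq (valP u) => ->; exact: valP.
  have -> : val v != val u' by apply: contraNneq (valP u') => <-; exact: valP.
  have -> : val u != val u' by rewrite (inj_eq val_inj).
  move: up; rewrite cons_uniq => /andP[-> ->]; rewrite /= andbT.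
  by rewrite mem_flat_white -(lifts_white rp).
- apply/allpairsP; exists (a :: q, r'); split=> //=.
  rewrite mem_gpaths /= ap eqxx -ap pq lq eqxx andbT.
  by move: uaq => /= ->.
Qed.

(** Without white vertices the walk stays inside a single copy of the gadget. *)
Lemma nonwhite_size z p : path tadj z p -> uniq (z :: p) ->
  ~~ has is_white (z :: p) -> (size p < #|K|)%N.
Proof.
case: z => [//|[v a]] pp up /=.
have chunkP : forall b, path tadj (inr (v, b)) p -> ~~ has is_white p ->
    exists q, p = chunk v q.
  elim: p {pp up} => [|[u|[v' b]] p IH] c //=; first by exists [::].
  by move=> /andP[/andP[/eqP <- _]] /IH /[apply] -[q ->]; exists (b :: q).
move=> /(chunkP a pp)[q pq]; move: up; rewrite pq.
rewrite -[_ :: _]/(chunk v (a :: q)) map_inj_uniq; last by move=> ? ? [].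
move=> uq; rewrite size_map cardE.
by apply: (@uniq_leq_size _ (a :: q)) => // x _; rewrite mem_enum.
Qed.

Lemma white_in_window z p i : path tadj z p -> uniq (z :: p) ->
  (i + #|K| <= size p)%N ->
  exists2 j, (j <= #|K|)%N & is_white (last z (take (i + j) p)).
Proof.
move=> pp up ip; pose s := take #|K| (drop i p); pose y := last z (take i p).
have ss : size s = #|K| by rewrite size_takel// size_drop leq_subRL// (leq_trans (leq_addr _ _) ip).
have [ps us] : path tadj y s /\ uniq (y :: s).
  move: pp up; rewrite -{1 2}(cat_take_drop i p) cat_path -cat_cons cat_uniq.
  move=> /andP[_ p2] /and3P[u1 u12 u2]; split; first exact: take_path.
  rewrite cons_uniq take_uniq// andbT; apply: contra u12 => /mem_take yd.
  by apply/hasP; exists y => //; exact: mem_last.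
have [sw|nsw] := boolP (has is_white (y :: s)); last first.
  by have := nonwhite_size ps us nsw; rewrite ss ltnn.
pose j := find is_white (y :: s).
have jK : (j <= #|K|)%N by move: sw; rewrite has_find -/j /= ss ltnS.
exists j => //; rewrite takeD last_cat -/y.
have -> : take j (drop i p) = take j s by rewrite /s take_takel.
have -> : last y (take j s) = nth y (y :: s) j.
  by move: jK; rewrite -ss; elim: (s) (y) (j) => [|c l IH] d [|m] //= ml; rewrite IH// (set_nth_default c).
exact: nth_find.
Qed.

(** * Generating functions of lifts *)

Variable R : realType.
Hypothesis valid : valid_gadget gadj w.
Local Notation series := (@gadget_series K gadj w R).

(** Weights multiply along the walk: each pair contributes [x] for its white vertex and a traversal
    series, which by [gsum_ports] is the same for all pairs of distinct ports. *)
Lemma sum_lifts u p (x : R) : path adj (val u) (flat p) -> uniq (val u :: flat p) ->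
  \sum_(r <- lifts u p) x ^+ size r = (x * series x) ^+ size p.
Proof.
elim: p u => [|[v u'] p IH] u; first by rewrite big_seq1.
rewrite /flat /= -/(flat p) !inE adj_sym => /and3P[vu vu' pp] /and3P[/norP[_ /norP[uu' _]] _ up].
rewrite big_allpairs_dep /= exprS -(IH u')//.
have [i pi] := port_index v u; have [j pj] := port_index v u'.
have ij : i != j.
  apply: contra uu' => /eqP ij; apply/eqP; congr val.
  by apply: (port_inj vu vu'); rewrite pi pj ij.
rewrite -(gsum_ports x valid ij) -pi -pj -sum_gpaths mulrAC mulr_sumr.
apply: eq_bigr => q _; rewrite mulrAC mulr_sumr; apply: eq_bigr => r _.
by rewrite size_cat size_map /= exprD exprS mulrCA mulrA.
Qed.

Variables (N : V -> seq V) (NT : tv -> seq tv).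
Hypothesis N_uniq : forall x, uniq (N x).
Hypothesis mem_N : forall x y, (y \in N x) = adj x y.
Hypothesis NT_uniq : forall x, uniq (NT x).
Hypothesis mem_NT : forall x y, (y \in NT x) = tadj x y.
Local Notation sigmaT := (sigma NT).
Local Notation sigma := (sigma N).

Lemma saws_flat (u : white) k : exists ps, [seq flat p | p <- ps] = saws N (val u) k.*2.
Proof.
have : {in saws N (val u) k.*2, forall p, exists p', flat p' = p}.
  move=> p; rewrite (mem_saws mem_N) => /and3P[/eqP sp pp _].
  exact: flat_surj pp sp.
elim: saws => [|p s IH] H; first by exists [::].
have [p' pE] := H p (mem_head _ _).
have [|ps <-] := IH; first by move=> q qs; apply: H; rewrite in_cons qs orbT.
by exists (p' :: ps); rewrite /= pE.
Qed.

Definition white_walks (u : white) (m : nat) : nat :=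
  count (fun q => is_white (last (inl u) q)) (saws NT (inl u) m).

(** By [white_saw_lift] each walk counted is a lift of a walk with [k.*2] steps, and [k <= m] by
    [lifts_size]. The right side sums the weights of all such lifts, whatever their length. *)
Lemma white_walks_upper (u : white) m (x : R) : 0 <= x ->
  (white_walks u m)%:R * x ^+ m <=
  \sum_(k < m.+1) (sigma (val u) k.*2)%:R * (x * series x) ^+ k.
Proof.
move=> x0; have /choice[ps Hps] := saws_flat u.
have psP k p : p \in ps k -> [/\ size p = k, path adj (val u) (flat p)
    & uniq (val u :: flat p)].
  move=> /(map_f flat); rewrite Hps (mem_saws mem_N) => /and3P[/eqP + -> ->].
  by rewrite size_flat => /double_inj ->.
pose A := [seq q <- saws NT (inl u) m | is_white (last (inl u) q)].
pose B := flatten [seq flatten [seq lifts u p | p <- ps k] | k <- iota 0 m.+1].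
have -> : (white_walks u m)%:R * x ^+ m = \sum_(r <- A) x ^+ size r.
  rewrite /white_walks -size_filter -/A; apply/esym/sum_const_seq => r.
  by rewrite mem_filter (mem_saws mem_NT) => /and3P[_ /eqP -> _].
have -> : \sum_(k < m.+1) (sigma (val u) k.*2)%:R * (x * series x) ^+ k =
    \sum_(r <- B) x ^+ size r.
  rewrite big_flatten big_map -[iota 0 m.+1]/(index_iota 0 m.+1) big_mkord.
  apply: eq_bigr => k _; rewrite big_flatten big_map.
  rewrite /sigma -Hps size_map; apply/esym/sum_const_seq.
  by move=> p /psP[sp pp up]; rewrite sum_lifts// sp.
apply: ler_sum_subset => [r||r]; [exact: exprn_ge0|exact/filter_uniq/saws_uniq|].
rewrite mem_filter (mem_saws mem_NT) => /and4P[rw /eqP rm pr ur].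
have [pp up rp] := white_saw_lift pr ur rw.
apply/flatten_mapP; exists (size (erase r)).
  have /andP[+ _] := lifts_size rp.
  by rewrite mem_iota rm add0n ltnS.
apply/flatten_mapP; exists (erase r) => //.
rewrite -(mem_map flat_inj) Hps (mem_saws mem_N) pp up size_flat eqxx //.
Qed.

(** The left side is the total weight of the lifts of all walks with [n.*2] steps; these are
    distinct self-avoiding walks with lengths in the stated range. *)
Lemma white_lifts_lower (u : white) n (x : R) : 0 <= x ->
  (sigma (val u) n.*2)%:R * (x * series x) ^+ n <=
  \sum_(n <= m < (#|K|.+1 * n).+1) (sigmaT (inl u) m)%:R * x ^+ m.
Proof.
move=> x0; have [ps Hps] := saws_flat u n.
have psP p : p \in ps -> [/\ size p = n, path adj (val u) (flat p)
    & uniq (val u :: flat p)].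
  move=> /(map_f flat); rewrite Hps (mem_saws mem_N) => /and3P[/eqP + -> ->].
  by rewrite size_flat => /double_inj ->.
have ups : uniq ps by rewrite -(map_inj_uniq flat_inj) Hps saws_uniq.
pose A := flatten [seq lifts u p | p <- ps].
pose B := flatten [seq saws NT (inl u) m | m <- index_iota n (#|K|.+1 * n).+1].
have -> : (sigma (val u) n.*2)%:R * (x * series x) ^+ n = \sum_(r <- A) x ^+ size r.
  rewrite big_flatten big_map.
  rewrite /sigma -Hps size_map; apply/esym/sum_const_seq.
  by move=> p /psP[sp pp up]; rewrite sum_lifts// sp.
have -> : \sum_(n <= m < (#|K|.+1 * n).+1) (sigmaT (inl u) m)%:R * x ^+ m =
    \sum_(r <- B) x ^+ size r.
  rewrite big_flatten big_map; apply: eq_bigr => m _.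
  by apply/esym/sum_const_seq => r; rewrite (mem_saws mem_NT) => /and3P[/eqP -> _ _].
apply: ler_sum_subset => [r||r]; first exact: exprn_ge0.
  have -> : A = [seq r | p <- ps, r <- lifts u p].
    by rewrite /A; congr flatten; apply: eq_map => p; rewrite map_id.
  apply: allpairs_uniq_dep => //; first by move=> p _; exact: lifts_uniq.
  move=> a b /allpairsPdep[p [r1 [_ rp ->]]] /allpairsPdep[p' [r2 [_ rp' ->]]] /= rr.
  by move: rp'; rewrite -rr => rp'; rewrite -(erase_lifts rp) -(erase_lifts rp').
move=> /flatten_mapP[p /psP[sp pp up] rp].
apply/flatten_mapP; exists (size r).
  by have := lifts_size rp; rewrite sp mem_index_iota ltnS.
by have [pr ur _] := lifts_saw pp up rp; rewrite (mem_saws mem_NT) eqxx pr ur.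
Qed.

(** A union bound over the position of a white vertex in the window of times from [i] to [i + #|K|];
    it reduces arbitrary walks to those with a white vertex at a known time. *)
Lemma sigma_window z n i (t : R) : (i + #|K| <= n)%N ->
  (forall j, (j <= #|K|)%N ->
    (count (fun q => is_white (last z (take (i + j) q))) (saws NT z n))%:R <= t) ->
  (sigmaT z n)%:R <= #|K|.+1%:R * t.
Proof.
move=> iKn Ht.
apply: (@le_trans _ _ (\sum_(j < #|K|.+1)
   (count (fun q => is_white (last z (take (i + j) q))) (saws NT z n))%:R)).
  rewrite -natr_sum ler_nat.
  have : {in saws NT z n, forall p, exists2 j, (j <= #|K|)%N &
      is_white (last z (take (i + j) p))}.
    move=> p; rewrite (mem_saws mem_NT) => /and3P[/eqP sp pp up].
    by apply: white_in_window; rewrite ?sp.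
  rewrite -[X in (X <= _)%N]/(size (saws NT z n)); elim: saws => [//|p s IH] H /=.
  rewrite big_split /= -add1n leq_add//; last first.
    by apply: IH => q qs; apply: H; rewrite in_cons qs orbT.
  have [j jK pj] := H p (mem_head _ _).
  by rewrite (bigD1 (Ordinal (jK : (j < #|K|.+1)%N)))//= pj.
apply: (@le_trans _ _ (\sum_(j < #|K|.+1) t)).
  by apply: ler_sum => -[j jK] _; exact: Ht.
by rewrite sumr_const card_ord mulr_natl.
Qed.

End Lifts.

(** * Growth rate of the transformed graph *)

Section TransformedGraph.
Variables (V : eqType) (adj : rel V) (chi : V -> bool).
Variables (K : finType) (gadj : rel K) (w : 'I_3 -> K) (nb : V -> 'I_3 -> V).
Hypothesis adj_sym : symmetric adj.
Hypothesis bip : bipartite_colouring adj chi.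
Hypothesis att : attachment adj chi nb.
Variable R : realType.
Hypothesis valid : valid_gadget gadj w.

Local Notation white := {u : V | ~~ chi u}.
Local Notation black := {v : V | chi v}.
Local Notation tv := (tvert chi K).
Local Notation tadj := (tadj adj chi gadj w nb).
Local Notation series := (@gadget_series K gadj w R).

Variable N : V -> seq V.
Hypothesis N_uniq : forall x, uniq (N x).
Hypothesis mem_N : forall x y, (y \in N x) = adj x y.

Lemma tadj_enum d : (forall x, size (N x) <= d)%N ->
  exists NT : tv -> seq tv, [/\ forall z, uniq (NT z),
    forall z z', (z' \in NT z) = tadj z z' &
    forall z, (size (NT z) <= d * #|K| + (#|K| + d))%N].
Proof.
move=> Nd.
pose L (z : tv) : seq tv := match z with
  | inl u => [seq inr (v, a) | v <- (pmap insub (N (val u)) : seq black), a <- enum K]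
  | inr (v, a) => [seq inr (v, b) | b <- enum K] ++
                  [seq inl u | u <- (pmap insub (N (val v)) : seq white)]
  end.
exists (fun z => undup [seq z' <- L z | tadj z z']); split.
- by move=> z; exact: undup_uniq.
- move=> z z'; rewrite mem_undup mem_filter andb_idr//.
  case: z z' => [u|[v a]] [u'|[v' b]] //=.
  + move=> /andP[uv _]; apply/allpairsP; exists (v', b); rewrite /= mem_enum; split=> //.
    by rewrite mem_pmap_sub mem_N.
  + move=> /andP[uv _]; rewrite mem_cat; apply/orP; right; apply: map_f.
    by rewrite mem_pmap_sub mem_N adj_sym.
  + move=> /andP[/eqP <- _]; rewrite mem_cat; apply/orP; left.
    by apply/mapP; exists b => //; rewrite mem_enum.
- move=> z; apply: leq_trans (size_undup _) _; rewrite size_filter.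
  apply: leq_trans (count_size _ _) _.
  have pm (P : pred V) (x : V) (S : subType P) : (size (pmap (insub : V -> option S) (N x)) <= d)%N.
    by rewrite size_pmap (leq_trans (count_size _ _)).
  case: z => [u|[v a]] /=.
    by rewrite size_allpairs -cardE (leq_trans _ (leq_addr _ _))// leq_mul2r pm orbT.
  by rewrite size_cat size_map -cardE size_map (leq_trans _ (leq_addl _ _))// leq_add2l pm.
Qed.

Lemma tadj_sym : symmetric tadj.
Proof.
have [[gs _] _ _ _] := valid.
by case=> [u|[v a]] [u'|[v' b]] //=; rewrite eq_sym gs.
Qed.

Lemma tadj_irrefl : irreflexive tadj.
Proof.
have [[_ gi] _ _ _] := valid.
by case=> [u|[v a]] //=; rewrite (negPf (gi a)) andbF.
Qed.

Variable NT : tv -> seq tv.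
Hypothesis NT_uniq : forall z, uniq (NT z).
Hypothesis mem_NT : forall z z', (z' \in NT z) = tadj z z'.
Variable D : nat.
Hypothesis NT_size : forall z, (size (NT z) <= D)%N.
Local Notation sigmaT := (sigma NT).
Local Notation sigma := (sigma N).

Variables (M x : R).
Hypotheses (M_gt0 : 0 < M) (x_gt0 : 0 < x) (x_le1 : x <= 1).
Hypothesis hx : x * series x = M ^- 2.

Lemma transformed_upper_rate : upper_rate sigma M -> upper_rate sigmaT x^-1.
Proof.
move=> up y xy; have [_ _ winj _] := valid.
have xi1 : 1 <= x^-1 by rewrite invf_ge1.
(* The gap between [x^-1] and [y0] puts [h] at [y0^-1] strictly below [M ^- 2]; the gap between [y0]
   and [y] absorbs a linear factor at the end. *)
have [y0 xy0 y0y] : exists2 y0, x^-1 < y0 & y0 < y.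
  by exists ((x^-1 + y) / 2); lra.
have y01 : 1 < y0 by lra.
have y00 : 0 < y0 by lra.
have x'0 : 0 < y0^-1 by rewrite invr_gt0.
have x'x : y0^-1 < x by rewrite invf_plt.
set h := y0^-1 * series y0^-1.
have h0 : 0 < h by rewrite mulr_gt0// gadget_series_gt0.
have hM : h < M ^- 2 by rewrite -hx; exact: h_lt.
have [r r1 Hr] := @root_between R (M ^- 2 / h) 2 ltac:(by rewrite ltr_pdivlMr// mul1r).
have r0 : 0 < r by lra.
have [B B0 HB] := up (M * r) ltac:(by rewrite ltr_pMr).
have hr : (M * r) ^+ 2 * h <= 1.
  rewrite exprMn -mulrA -ler_pdivlMl ?exprn_gt0// mulr1.
  by rewrite -ler_pdivlMr.
have Bk v k : (sigma v k.*2)%:R * h ^+ k <= B.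
  apply: le_trans (_ : B * (M * r) ^+ k.*2 * h ^+ k <= _).
    by apply: ler_wpM2r; [rewrite exprn_ge0// ltW|exact: HB].
  rewrite -muln2 mulnC exprM -mulrA -exprMn ler_piMr ?(ltW B0)//.
  by apply: exprn_ile1 => //; rewrite mulr_ge0 ?sqr_ge0// ltW.
(* Walks between white vertices: each of the [m.+1] terms of [white_walks_upper] is at most [B]. *)
have ww u m : (white_walks NT u m)%:R <= B * m.+1%:R * y0 ^+ m.
  have := white_walks_upper adj_sym bip att winj valid mem_N NT_uniq mem_NT u m (ltW x'0).
  rewrite -/h exprVn ler_pdivrMr ?exprn_gt0// => /le_trans; apply.
  apply: ler_wpM2r; first by rewrite exprn_ge0// ltW.
  apply: (@le_trans _ _ (\sum_(k < m.+1) B)); first exact: ler_sum.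
  by rewrite sumr_const card_ord mulr_natr.
(* The base [D.+1] is positive even for [D = 0], so this power bounds the counts of all lengths up
   to [#|K|]. *)
pose E : R := D.+1%:R ^+ #|K|.
have E1 : 1 <= E by apply: exprn_ege1; rewrite ler1n.
have E0 : 0 <= E by lra.
have sE z k : (k <= #|K|)%N -> (sigmaT z k)%:R <= E.
  move=> kK; apply: le_trans (_ : (D.+1 ^ k)%:R <= _).
    rewrite ler_nat; apply: (sigma_exp NT_uniq mem_NT) => z'.
    by rewrite (sigma1 mem_NT _ tadj_irrefl) (leq_trans (NT_size _)).
  by rewrite /E -natrX ler_nat leq_pexp2l.
have yn n : 1 <= n.+1%:R * y0 ^+ n.
  by apply: mulr_ege1; [rewrite ler1n|apply: exprn_ege1; exact: ltW].
(* White start, arbitrary end: cut at a white vertex met in the last [#|K|] steps. The summand [E]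
   of the constant covers [n < #|K|]. *)
have [C1 C10 HC1] : exists2 C, 0 < C & forall u n,
    (sigmaT (inl u) n)%:R <= C * (n.+1%:R * y0 ^+ n).
  exists (#|K|.+1%:R * B * E + E); first by rewrite ltr_wpDl// ?mulr_ge0//; [exact: ltW|lra].
  move=> u n; have [nK|Kn] := ltnP n #|K|.
    apply: le_trans (sE _ _ (ltnW nK)) _; rewrite mulrDl.
    apply: le_trans (_ : E * (n.+1%:R * y0 ^+ n) <= _); first by rewrite ler_peMr.
    rewrite lerDr mulr_ge0 ?mulr_ge0// ?ltW//.
    by rewrite exprn_gt0.
  apply: le_trans (_ : _ <= #|K|.+1%:R * (B * E * (n.+1%:R * y0 ^+ n))) _; last first.
    have -> : #|K|.+1%:R * (B * E * (n.+1%:R * y0 ^+ n)) = #|K|.+1%:R * B * E * (n.+1%:R * y0 ^+ n) by ring.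
    apply: ler_wpM2r; last by rewrite lerDl.
    exact: le_trans (yn n).
  apply: (sigma_window mem_NT (i := (n - #|K|)%N)); first by rewrite subnK.
  move=> j jK; pose m := (n - #|K| + j)%N.
  have mn : (m <= n)%N by rewrite /m; clear -jK Kn; lia.
  have nE : n = (m + (#|K| - j))%N by rewrite /m; clear -jK Kn; lia.
  rewrite -/m {1}nE.
  apply: le_trans (count_saws_cutr NT_uniq mem_NT (A := fun q => is_white (last (inl u) q)) E0 _) _.
    by move=> q _ _; apply: sE; exact: leq_subr.
  rewrite -/(white_walks NT u m).
  have -> : B * E * (n.+1%:R * y0 ^+ n) = B * (n.+1%:R * y0 ^+ n) * E by ring.
  apply: ler_wpM2r => //; apply: le_trans (ww u m) _; rewrite -mulrA.
  apply: ler_wpM2l; first exact: ltW.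
  apply: ler_pM => //; first by rewrite exprn_ge0// ltW.
    by rewrite ler_nat.
  by rewrite ler_eXn2l.
(* Arbitrary start: cut at a white vertex met in the first [#|K|] steps and apply the previous bound
   to the rest. *)
have [C2 C20 HC2] : exists2 C, 0 < C & forall z n,
    (sigmaT z n)%:R <= C * (n.+1%:R * y0 ^+ n).
  exists (#|K|.+1%:R * C1 * E + E); first by rewrite ltr_wpDl// ?mulr_ge0//; [exact: ltW|lra].
  move=> z n; have [nK|Kn] := ltnP n #|K|.
    apply: le_trans (sE _ _ (ltnW nK)) _; rewrite mulrDl.
    apply: le_trans (_ : E * (n.+1%:R * y0 ^+ n) <= _); first by rewrite ler_peMr.
    rewrite lerDr mulr_ge0 ?mulr_ge0// ?ltW//.
    by rewrite exprn_gt0.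
  have C1n : 0 <= C1 * (n.+1%:R * y0 ^+ n).
    by rewrite mulr_ge0 ?(ltW C10)// (le_trans _ (yn n)).
  apply: le_trans (_ : _ <= #|K|.+1%:R * (E * (C1 * (n.+1%:R * y0 ^+ n)))) _; last first.
    have -> : #|K|.+1%:R * (E * (C1 * (n.+1%:R * y0 ^+ n))) = #|K|.+1%:R * C1 * E * (n.+1%:R * y0 ^+ n) by ring.
    apply: ler_wpM2r; last by rewrite lerDl.
    exact: le_trans (yn n).
  apply: (sigma_window mem_NT (i := 0%N)) => // j jK; rewrite add0n.
  rewrite -{1}(subnKC (leq_trans jK Kn)).
  apply: le_trans (count_saws_cutr NT_uniq mem_NT (A := fun q => is_white (last z q)) C1n _) _.
    move=> q _; case: (last z q) => [u _|//].
    apply: le_trans (HC1 u _) _; apply: ler_wpM2l; first exact: ltW.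
    apply: ler_pM => //; first by rewrite exprn_ge0// ltW.
      by rewrite ler_nat ltnS leq_subr.
    by rewrite ler_eXn2l// leq_subr.
  apply: ler_wpM2r => //; apply: le_trans (sE z j jK).
  by rewrite ler_nat count_size.
have [L L0 HL] := @linear_geometric R (y / y0) ltac:(by rewrite ltr_pdivlMr// mul1r).
exists (C2 * L); first exact: mulr_gt0.
move=> z n; apply: le_trans (HC2 z n) _; rewrite -mulrA.
apply: ler_wpM2l; first exact: ltW.
by rewrite -ler_pdivlMr ?exprn_gt0// -mulrA -expr_div_n.
Qed.

Lemma transformed_lower_rate (u : white) : upper_rate sigmaT x^-1 ->
  lower_rate (sigma (val u)) M -> lower_rate (sigmaT (inl u)) x^-1.
Proof.
move=> up lo y /andP[y0 yx]; have [_ _ winj _] := valid.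
have xi0 : 0 < x^-1 by rewrite invr_gt0.
pose L := #|K|.+1.
(* The factors [r] lost per step: [L] from the upper rate over up to [L * n] steps, two from the
   lower rate [M / r] on walks with [n.*2] steps, one from the number of lengths. *)
have [r r1 Hr] := @root_between R (x^-1 / y) (L + 3) ltac:(by rewrite ltr_pdivlMr// mul1r).
have r0 : 0 < r by lra.
have [C C0 HC] := up (x^-1 * r) ltac:(by rewrite ltr_pMr).
have [c c0 Hc] := lo (M / r) ltac:(by rewrite divr_gt0//= ltr_pdivrMr// ltr_pMr).
have [A A0 HA] := linear_geometric r1.
pose Q := L%:R * A * C.
have Q0 : 0 < Q by rewrite !mulr_gt0// ltr0n.
exists (c / Q); first exact: divr_gt0.
move=> n; set s := (sigmaT (inl u) n)%:R.
have s0 : 0 <= s by [].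
(* Cut after [n] steps and bound the rest by the upper rate; the powers of [x] then combine to
   [x ^+ n]. *)
have term m : (n <= m <= L * n)%N ->
    (sigmaT (inl u) m)%:R * x ^+ m <= s * x ^+ n * (C * r ^+ (L * n)).
  move=> /andP[nm mL].
  have := @sigma_addr R _ _ _ NT_uniq mem_NT (inl u) n (m - n) _ (fun z => HC z _).
  rewrite subnKC// -/s => H.
  apply: le_trans (_ : s * (C * (x^-1 * r) ^+ (m - n)) * x ^+ m <= _).
    by apply: ler_wpM2r => //; rewrite exprn_ge0// ltW.
  have -> : s * (C * (x^-1 * r) ^+ (m - n)) * x ^+ m = s * x ^+ n * (C * r ^+ (m - n)).
    rewrite -{2}(subnKC nm) exprD exprMn exprVn; field.
    by rewrite expf_neq0// gt_eqF.
  apply: ler_wpM2l; first by rewrite mulr_ge0// exprn_ge0// ltW.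
  apply: ler_wpM2l; first exact: ltW.
  by rewrite ler_eXn2l// (leq_trans (leq_subr _ _)).
have main : c * (r ^- 2) ^+ n <= s * x ^+ n * (C * r ^+ (L * n)) * (L%:R * (A * r ^+ n)).
  apply: le_trans (_ : _ <= (sigma (val u) n.*2)%:R * (x * series x) ^+ n) _.
    have -> : c * (r ^- 2) ^+ n = c * (M / r) ^+ n.*2 * (x * series x) ^+ n.
      rewrite hx -muln2 mulnC exprM -mulrA -exprMn; congr (_ * _ ^+ _).
      by field; rewrite !gt_eqF.
    by apply: ler_wpM2r => //; rewrite hx exprn_ge0// invr_ge0 exprn_ge0// ltW.
  apply: le_trans (white_lifts_lower adj_sym bip att winj valid N_uniq mem_N mem_NT u n (ltW x_gt0)) _.
  apply: (@le_trans _ _ (\sum_(n <= m < (L * n).+1) s * x ^+ n * (C * r ^+ (L * n)))).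
    by apply: ler_sum_nat => m; rewrite ltnS; exact: term.
  rewrite sumr_const_nat -[leLHS]mulr_natr; apply: ler_wpM2l.
    by rewrite !mulr_ge0// ?exprn_ge0// ltW.
  apply: le_trans (_ : _ <= L%:R * n.+1%:R) _; last by rewrite ler_pM2l ?ltr0n.
  rewrite -natrM ler_nat (leq_trans (leq_subr _ _))// mulnS.
  by rewrite -add1n leq_add2r.
have yr : y <= x^-1 / r ^+ (L + 3).
  by rewrite ler_pdivlMr ?exprn_gt0// mulrC -ler_pdivlMr.
apply: le_trans (_ : c / Q * (x^-1 / r ^+ (L + 3)) ^+ n <= _).
  apply: ler_wpM2l; first by rewrite divr_ge0// ltW.
  by apply: lerXn2r => //; rewrite nnegrE ?divr_ge0 ?exprn_ge0// ltW.
rewrite mulrAC ler_pdivrMr//.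
have d0 : 0 < x ^+ n * r ^+ (L * n) * r ^+ n by rewrite !mulr_gt0// exprn_gt0.
rewrite -(ler_pM2r d0).
have -> : c * (x^-1 / r ^+ (L + 3)) ^+ n * (x ^+ n * r ^+ (L * n) * r ^+ n) = c * (r ^- 2) ^+ n.
  rewrite exprM -mulrA -!exprMn; congr (_ * _ ^+ _).
  rewrite exprD; field.
  by rewrite expf_neq0 ?gt_eqF.
by apply: le_trans main _; rewrite le_eqVlt; apply/orP; left; apply/eqP; rewrite /Q; ring.
Qed.

End TransformedGraph.

(** * Connective constants of the two graphs *)

Lemma finitely_many_sigma (V : eqType) (adj : rel V) (chi : V -> bool)
    (N : V -> seq V) : (forall x, uniq (N x)) ->
    (forall x y, (y \in N x) = adj x y) -> coloured_quasi_transitive adj chi ->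
  exists W : seq V, forall x, exists2 w, w \in W & forall n, sigma N x n = sigma N w n.
Proof.
move=> Nu mN [W [/finite_seqP[s ->] HW]]; exists s => v.
have [f [[fbij [fadj _]] Wfv]] := HW v; exists (f v) => // n.
by rewrite (sigma_aut Nu mN).
Qed.

Lemma neighbour_enum (V : eqType) (adj : rel V) : locally_finite adj ->
  exists N : V -> seq V, (forall x, uniq (N x)) /\ forall x y, (y \in N x) = adj x y.
Proof.
move=> lf; have /choice[L HL] : forall x, exists s : seq V, [set y | adj x y] = [set` s].
  by move=> x; apply/finite_seqP.
exists (fun x => undup (L x)); split=> [x|x y]; first exact: undup_uniq.
rewrite mem_undup; have /(congr1 (fun A => A y)) /= := HL x.
by move=> E; apply/idP/idP; rewrite E.
Qed.

Unset Implicit Arguments.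

Theorem theorem3p5 (R : realType) (V : eqType) (adj : rel V) (chi : V -> bool)
  (K : finType) (gadj : rel K) (w : 'I_3 -> K) (nb : V -> 'I_3 -> V) :
  simple_graph adj -> infinite_graph V -> graph_connected adj ->
  locally_finite adj ->
  bipartite_colouring adj chi ->
  coloured_quasi_transitive adj chi ->
  (forall v, chi v -> [set u | adj v u] #= `I_3) ->
  valid_gadget gadj w ->
  attachment adj chi nb ->
  graph_connected (tadj adj chi gadj w nb) ->
  exists mu mut : R,
    [/\ connective_constant adj mu,
        connective_constant (tadj adj chi gadj w nb) mut &
        mu ^- 2 = mut^-1 * gadget_series gadj w mut^-1].
Proof.
move=> [adj_sym adj_irr] inf conn lf bip qt _ valid att connT.
have adj_irrefl : irreflexive adj by move=> x; exact/negbTE.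
have [N [N_uniq mem_N]] := neighbour_enum lf.
have [W W_types] := finitely_many_sigma N_uniq mem_N qt.
have [v0] : exists v0 : V, True.
  apply: contrapT => nV; apply: inf; apply: (@sub_finite_set _ _ set0) => // x _.
  by apply: nV; exists x.
move=> _.
have [M [M1 up [v1 lo1]]] := @growth_rate_exists R _ _ _ N_uniq mem_N W W_types v0
  (fun x n => sigma_gt0 mem_N x n inf conn).
have M0 : 0 < M by lra.
have lo v : lower_rate (sigma N v) M.
  exact: (lower_rate_connected N_uniq mem_N v adj_sym adj_irrefl conn M0 up lo1).
(* One-step walks count neighbours, so this bounds the degrees. *)
have [d Hd] := sigma_bounded W_types 1.
have [NT [NT_uniq mem_NT NT_size]] : exists NT : tvert chi K -> seq (tvert chi K),
    [/\ forall z, uniq (NT z),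
      forall z z', (z' \in NT z) = tadj adj chi gadj w nb z z' &
      forall z, (size (NT z) <= d * #|K| + (#|K| + d))%N].
  by apply: (tadj_enum chi gadj w nb adj_sym mem_N) => x; rewrite -(sigma1 mem_N _ adj_irrefl).
(* Solvable because [1 <= M]; the inverse of [x] will be the connective constant of the transformed
   graph. *)
have [x [x0 x1 hx]] : exists x : R, [/\ 0 < x, x <= 1 & x * gadget_series gadj w x = M ^- 2].
  apply: h_surj => //; rewrite invr_gt0 exprn_gt0//= invf_le1 ?exprn_gt0//.
  by apply: exprn_ege1.
have [u wu] : exists u, ~~ chi u.
  have [b|?] := boolP (chi v0); last by exists v0.
  have e : adj v0 (nb v0 ord0) by apply/(proj2 (att v0 b)); exists ord0.
  by exists (nb v0 ord0); move: (bip _ _ e); rewrite b; case: (chi _).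
pose u' : {u : V | ~~ chi u} := exist _ u wu.
have upT : upper_rate (sigma NT) x^-1.
  exact: (transformed_upper_rate adj_sym bip att valid mem_N NT_uniq mem_NT NT_size M0 x0 x1 hx up).
have loT : lower_rate (sigma NT (inl u')) x^-1.
  exact: (transformed_lower_rate adj_sym bip att valid N_uniq mem_N NT_uniq mem_NT M0 x0 hx upT (lo (val u'))).
exists M, x^-1; split.
- exact: (connective_constant_rate N_uniq mem_N adj_sym adj_irrefl conn M0 up lo1).
- apply: (connective_constant_rate NT_uniq mem_NT _ _ connT _ upT loT).
  + exact: tadj_sym valid.
  + exact: tadj_irrefl valid.
  + by rewrite invr_gt0.
- by rewrite invrK hx.
Qed.
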